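(* Let $D$ be a weighted oriented cycle of length $n$ with $n\equiv 0$ or $1\pmod 3$, with underlying graph $G=C_n=x_1\cdots x_nx_1$, such that every vertex of $V^+$ is a sink. Then $$\operatorname{reg}(I(D))=\operatorname{reg}(I(G))+\sum_{x_i\in V^+}(w(x_i)-1).$$
   Context: A weighted oriented graph $D=(V(D),E(D),w)$ has directed edges $(x,y)$ and weights $w:V(D)\to\{1,2,\dots\}$; a source is assumed to have weight $1$. Its edge ideal is $I(D)=(x_ix_j^{w(x_j)}:(x_i,x_j)\in E(D))$ in the polynomial ring over a field whose variables are the vertices; $I(G)$ is the usual squarefree edge ideal of the simple underlying graph $G$. $V^+=\{x\in V(D): w(x)\ge 2\}$. A sink is a vertex all of whose incident edges are oriented into it. $\operatorname{reg}$ is Castelnuovo–Mumford regularity. *)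

(* Defs.v *)
From Stdlib Require ClassicalEpsilon.
From mathcomp Require Import all_boot all_order all_algebra.
From mathcomp Require Import mpoly.

Set Implicit Arguments.
Unset Strict Implicit.
Unset Printing Implicit Defensive.

Import GRing.Theory Num.Theory.
Local Open Scope ring_scope.

Section Ideals.
Variables (K : fieldType) (n : nat).
Local Notation S := {mpoly K[n]}.

Definition ideal_span (P : S -> Prop) (f : S) : Prop :=
  exists (m : nat) (c g : 'I_m -> S),
    (forall i, P (g i)) /\ f = \sum_(i < m) c i * g i.

(* The free module F_i is the direct sum of the S(-j), j = shift i a, for
   a < rank i. Its elements are row vectors, and maps act on the right:
   diff i is F_(i+1) -> F_i and aug is F_0 -> S. *)
Record free_complex := FreeComplex {
  rank : nat -> nat;
  shift : forall i, 'I_(rank i) -> nat;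
  diff : forall i, 'M[S]_(rank i.+1, rank i);
  aug : 'cV[S]_(rank 0)
}.

(* Multiplication by p is a degree-preserving map S(-b) -> S(-a). *)
Definition degree_preserving (p : S) (b a : nat) : Prop :=
  forall m, m \in msupp p -> (mdeg m + a)%N = b.

Definition is_graded (F : free_complex) : Prop :=
  (forall a, degree_preserving (aug F a 0) (shift a) 0) /\
  (forall i (b : 'I_(rank F i.+1)) (a : 'I_(rank F i)),
     degree_preserving (diff F i b a) (shift b) (shift a)).

Definition is_resolution (F : free_complex) (I : S -> Prop) : Prop :=
  [/\ forall f, I f <-> exists v : 'rV[S]_(rank F 0), (v *m aug F) 0 0 = f,
      forall v : 'rV[S]_(rank F 0),
        v *m aug F = 0 <-> exists u, v = u *m diff F 0
    & forall i (v : 'rV[S]_(rank F i.+1)),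
        v *m diff F i = 0 <-> exists u, v = u *m diff F i.+1].

(* All matrix entries lie in the maximal ideal generated by the variables. *)
Definition is_minimal (F : free_complex) : Prop :=
  forall i (b : 'I_(rank F i.+1)) (a : 'I_(rank F i)),
    (diff F i b a)@_0%MM = 0.

Definition betti (F : free_complex) (i j : nat) : nat :=
  #|[set a : 'I_(rank F i) | shift a == j]|.

Definition has_reg (I : S -> Prop) (r : int) : Prop :=
  exists F : free_complex,
    [/\ is_graded F, is_resolution F I, is_minimal F,
        exists i j, betti F i j <> 0%N /\ r = j%:Z - i%:Z
      & forall i j, betti F i j <> 0%N -> j%:Z - i%:Z <= r].

(* A nonzero homogeneous ideal has a minimal graded free resolution, unique up
   to isomorphism and of finite length, so exactly one r satisfies has_reg. The
   value is unspecified for other I. *)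
Definition reg (I : S -> Prop) : int :=
  ClassicalEpsilon.epsilon (inhabits (0 : int)) (has_reg I).

End Ideals.

Definition underlying n (e : rel 'I_n) : rel 'I_n :=
  fun x y => e x y || e y x.

Definition is_source n (e : rel 'I_n) (x : 'I_n) : Prop :=
  forall y, underlying e x y -> e x y.

Definition is_sink n (e : rel 'I_n) (x : 'I_n) : Prop :=
  forall y, underlying e x y -> e y x.

Record wograph (n : nat) := WOGraph {
  arcs : rel 'I_n;
  weight : 'I_n -> nat;
  arcs_asym : forall x y, arcs x y -> ~~ arcs y x;
  weight_gt0 : forall x, (0 < weight x)%N;
  weight_source : forall x, is_source arcs x -> weight x = 1%N
}.

Definition Vplus n (D : wograph n) : {set 'I_n} :=
  [set x | (2 <= weight D x)%N].

(* ordS is the successor modulo n. *)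
Definition cycle_adj n : rel 'I_n :=
  fun x y => (y == ordS x) || (x == ordS y).

Definition is_wocycle n (D : wograph n) : Prop :=
  (2 < n)%N /\ forall x y, underlying (arcs D) x y = cycle_adj x y.

Definition edge_ideal (K : fieldType) n (e : rel 'I_n) :
    {mpoly K[n]} -> Prop :=
  ideal_span (fun f => exists x y, e x y /\ f = 'X_x * 'X_y).

Definition wo_edge_ideal (K : fieldType) n (D : wograph n) :
    {mpoly K[n]} -> Prop :=
  ideal_span
    (fun f => exists x y, arcs D x y /\ f = 'X_x * 'X_y ^+ weight D y).

Arguments edge_ideal K [n] e.
Arguments wo_edge_ideal K [n] D.

(* Main.v *)
(* Since every vertex of V^+ is a sink, I(D) arises from I(C_n) by the
   substitution x -> x^(w x). A resolution of a squarefree monomial ideal whose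
   generators are labelled by squarefree monomials (sets A of vertices) stays a
   resolution after this substitution, the degree #|A| becoming the sum of
   w x over A. For n = 0, 1 mod 3, the maximum of #|A| - i over the generators
   labelled A in homological degree i is attained at A = all vertices, and this
   generator survives minimalization since the full label occurs in only one
   homological degree; so the regularity grows by the sum of w x - 1 over all
   vertices. The resolution of C_n comes from iterated mapping cones: adding an
   edge x_m x_(m+1) to the edge ideal of the path x_1 ... x_m, the colon ideal
   is x_(m-1) plus the edge ideal of x_1 ... x_(m-2), and adding the edge
   x_n x_1 to the path x_1 ... x_n, it is x_2, x_(n-1) plus the edge ideal of
   x_3 ... x_(n-2). *)
Require Import Defs.
From mathcomp Require Import all_boot all_order all_algebra.
From mathcomp Require Import mpoly zify.

Set Implicit Arguments.
Unset Strict Implicit.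
Unset Printing Implicit Defensive.

Import Order.TTheory GRing.Theory Num.Theory.
Local Open Scope ring_scope.

(** * Comparison of graded resolutions *)

Section RowChoice.
Variable R : pzRingType.

Lemma row_factor m n p (N : 'M[R]_(m, n)) (M : 'M[R]_(p, n)) :
  (forall i, exists u, row i N = u *m M) -> exists X, N = X *m M.
Proof.
move=> /fin_all_exists[u Hu]; exists (\matrix_i u i).
by apply/row_matrixP => i; rewrite row_mul rowK.
Qed.

End RowChoice.

Section Comparison.
Variables (K : fieldType) (n : nat).
Local Notation S := {mpoly K[n]}.

(* The component of p that maps S(-b) to S(-a) in degree zero. *)
Definition graded_part (b a : nat) (p : S) : S :=
  \sum_(m <- msupp p | mdeg m + a == b) p@_m *: 'X_[m].

Lemma mcoeff_graded_part b a p m :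
  (graded_part b a p)@_m = if (mdeg m + a == b)%N then p@_m else 0.
Proof.
rewrite /graded_part raddf_sum /=.
under eq_bigr do rewrite mcoeffZ mcoeffX.
case: (boolP (m \in msupp p)) => [mp|nmp].
  rewrite big_mkcond (bigD1_seq m) ?msupp_uniq //= eqxx mulr1 big1 ?addr0 //.
  by move=> k km; rewrite (negPf km) mulr0 if_same.
rewrite big_seq_cond big1 => [|k /andP[kp _]].
  by rewrite (eqP (_ : p@_m == 0)) ?if_same // mcoeff_eq0.
have /negPf-> : k != m by apply: contraNneq nmp => <-.
by rewrite mulr0.
Qed.

Lemma graded_part_degree b a p : degree_preserving (graded_part b a p) b a.
Proof.
by move=> m; rewrite mcoeff_msupp mcoeff_graded_part; case: (_ =P b); rewrite ?eqxx.
Qed.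

Lemma graded_part_id b a p : degree_preserving p b a -> graded_part b a p = p.
Proof.
move=> hp; apply/mpolyP => m; rewrite mcoeff_graded_part.
case: eqP => // ne; apply/esym/eqP; rewrite mcoeff_eq0.
by apply/negP => /hp.
Qed.

Lemma graded_partMr c b a p q : degree_preserving q b a ->
  graded_part c a (p * q) = graded_part c b p * q.
Proof.
move=> hq; apply/mpolyP => m; rewrite mcoeff_graded_part !mcoeffM.
have E (k : 'X_{1..n < (mdeg m).+1, (mdeg m).+1}) : m == (k.1 + k.2)%MM ->
  (graded_part c b p)@_k.1 * q@_k.2 =
  if (mdeg m + a == c)%N then p@_k.1 * q@_k.2 else 0.
  move=> /eqP mk; rewrite mcoeff_graded_part.
  case: (boolP (val k.2 \in msupp q)) => [/hq eb|]; last first.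
    by rewrite -mcoeff_eq0 => /eqP->; rewrite !mulr0 if_same.
  have -> : (mdeg m + a = mdeg k.1 + b)%N by rewrite -eb addnA -mdegD -mk.
  by case: ifP; rewrite ?mul0r.
by rewrite [RHS](eq_bigr _ E); case: ifP => // _; rewrite big1.
Qed.

Lemma graded_part_sum c a I (r : seq I) (F : I -> S) :
  graded_part c a (\sum_(i <- r) F i) = \sum_(i <- r) graded_part c a (F i).
Proof.
apply/mpolyP => m; rewrite mcoeff_graded_part !raddf_sum /=.
under [RHS]eq_bigr do rewrite mcoeff_graded_part.
by case: ifP => // _; rewrite big1.
Qed.

Definition graded_mx p q (s : 'I_p -> nat) (t : 'I_q -> nat) (M : 'M[S]_(p, q))
  := forall a b, degree_preserving (M a b) (s a) (t b).

Lemma graded_mxM p q r (s : 'I_p -> nat) (t : 'I_q -> nat) (v : 'I_r -> nat) M N :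
  graded_mx s t M -> graded_mx t v N -> graded_mx s v (M *m N).
Proof.
move=> hM hN a b.
suff -> : (M *m N) a b = graded_part (s a) (v b) ((M *m N) a b).
  exact: graded_part_degree.
rewrite mxE graded_part_sum; apply: eq_bigr => j _.
by rewrite (graded_partMr _ _ (hN j b)) graded_part_id.
Qed.

(** [Y] and [M] are graded, so replacing every entry of [X] by its graded part leaves the product
    unchanged. *)
Lemma graded_factor p q r (s : 'I_p -> nat) (t : 'I_q -> nat) (v : 'I_r -> nat)
    (Y : 'M[S]_(p, r)) (M : 'M[S]_(q, r)) :
  graded_mx s v Y -> graded_mx t v M ->
  (exists X, Y = X *m M) -> exists X, graded_mx s t X /\ Y = X *m M.
Proof.
move=> hY hM [X YX]; exists (\matrix_(a, b) graded_part (s a) (t b) (X a b)).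
split=> [a b|]; first by rewrite mxE; apply: graded_part_degree.
apply/matrixP => a b; rewrite -(graded_part_id (hY a b)) YX !mxE graded_part_sum.
by apply: eq_bigr => j _; rewrite mxE (graded_partMr _ _ (hM j b)).
Qed.

Lemma ker_factor p q r s (M : 'M[S]_(q, r)) (N : 'M[S]_(p, q)) (Y : 'M[S]_(s, q)) :
  (forall v : 'rV_q, v *m M = 0 <-> exists u, v = u *m N) ->
  Y *m M = 0 -> exists X, Y = X *m N.
Proof.
move=> ex YM; apply: row_factor => i; apply/ex.
by rewrite -row_mul YM row0.
Qed.

Lemma ker_factor0 p q r (M : 'M[S]_(q, r)) (N : 'M[S]_(p, q)) :
  (forall v : 'rV_q, v *m M = 0 <-> exists u, v = u *m N) -> N *m M = 0.
Proof.
move=> ex; apply/row_matrixP => i; rewrite row_mul row0; apply/ex.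
by exists (delta_mx 0 i); rewrite rowE.
Qed.

Definition const_mx0 p q (M : 'M[S]_(p, q)) : 'M[K]_(p, q) :=
  map_mx (mcoeff 0%MM) M.

Variable I : S -> Prop.

Lemma aug_factor F F' : is_resolution F I -> is_resolution F' I ->
  exists X, aug F = X *m aug F'.
Proof.
move=> [augF _ _] [augF' _ _]; apply: row_factor => i.
have [u hu] : exists u : 'rV_(rank F' 0), (u *m aug F') 0 0 = aug F i 0.
  apply/augF'/augF; exists (delta_mx 0 i).
  by rewrite -rowE mxE.
by exists u; apply/matrixP => a b; rewrite !ord1 hu mxE.
Qed.

(* The matrix E is d h for the homotopy h of the previous degree; by minimality
   both h d and E vanish modulo the variables, so phi psi is the identity
   there. *)
Lemma comparison_step F F' i :
  is_graded F -> is_resolution F I -> is_minimal F ->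
  is_graded F' -> is_resolution F' I ->
  exists (phi : 'M[S]_(rank F i, rank F' i)) (psi : 'M[S]_(rank F' i, rank F i)),
    [/\ graded_mx (@shift _ _ F i) (@shift _ _ F' i) phi,
        exists X, diff F i *m phi = X *m diff F' i,
        exists Y, diff F' i *m psi = Y *m diff F i
      & exists (h : 'M_(rank F i, rank F i.+1)) E,
        [/\ 1%:M - phi *m psi = h *m diff F i + E, diff F i *m E = 0
          & const_mx0 E = 0] ].
Proof.
move=> gF rF mF gF' rF'.
have [_ exF0 exF] := rF; have [_ exF'0 exF'] := rF'.
elim: i => [|i [phi [psi [gphi [X hX] [Y hY] [h [E [hh hE E0]]]]]]].
  have [phi [gphi hphi]] : exists phi,
      graded_mx (@shift _ _ F 0) (@shift _ _ F' 0) phi /\ aug F = phi *m aug F'.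
    apply: (@graded_factor _ _ _ _ _ (fun _ : 'I_1 => 0%N)) => [a b|a b|].
    - by rewrite ord1; apply: gF.1.
    - by rewrite ord1; apply: gF'.1.
    - exact: aug_factor.
  have [psi hpsi] := aug_factor rF' rF.
  exists phi, psi; split=> //.
  - apply: (ker_factor exF'0).
    by rewrite -mulmxA -hphi (ker_factor0 exF0).
  - apply: (ker_factor exF0).
    by rewrite -mulmxA -hpsi (ker_factor0 exF'0).
  - have [h hh] : exists h, 1%:M - phi *m psi = h *m diff F 0.
      apply: (ker_factor exF0).
      by rewrite mulmxBl mul1mx -mulmxA -hpsi -hphi subrr.
    exists h, 0; rewrite hh addr0 mulmx0; split=> //.
    by apply/matrixP => a b; rewrite !mxE mcoeff0.
have [phi' [gphi' hphi']] : exists phi',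
    graded_mx (@shift _ _ F i.+1) (@shift _ _ F' i.+1) phi' /\
    diff F i *m phi = phi' *m diff F' i.
  apply: (@graded_factor _ _ _ _ _ (@shift _ _ F' i)) => [|a b|].
  - by apply: graded_mxM gphi => a b; apply: gF.2.
  - exact: gF'.2.
  - by exists X.
(* [Y] serves as the next [psi] as it is; [phi] alone is regraded, since degrees are later read off
   its entries only. *)
exists phi', Y; split=> //.
- apply: (ker_factor (exF' i)).
  by rewrite -mulmxA -hphi' mulmxA (ker_factor0 (exF i)) mul0mx.
- apply: (ker_factor (exF i)).
  by rewrite -mulmxA -hY mulmxA (ker_factor0 (exF' i)) mul0mx.
have [h' hh'] : exists h', 1%:M - phi' *m Y - diff F i *m h = h' *m diff F i.+1.
  apply: (ker_factor (exF i)).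
  rewrite !mulmxBl mul1mx -mulmxA -hY mulmxA -hphi' -!mulmxA.
  have : diff F i *m (1%:M - phi *m psi) = diff F i *m (h *m diff F i + E) by rewrite hh.
  rewrite mulmxBr mulmx1 mulmxDr hE addr0 => ->.
  by rewrite subrr.
exists h', (diff F i *m h); split.
- by rewrite -hh' subrK.
- by rewrite mulmxA (ker_factor0 (exF i)) mul0mx.
- rewrite /const_mx0 map_mxM /=.
  suff -> : map_mx (mcoeff 0%MM) (diff F i) = 0 by rewrite mul0mx.
  by apply/matrixP => a b; rewrite !mxE mF.
Qed.

(** By minimality [phi *m psi] is the identity modulo the variables, so row [a] of [phi] has an
    entry with nonzero constant term. As [phi] preserves degrees, that entry joins generators of
    equal shift. *)
Lemma betti_comparison F F' i j :
  is_graded F -> is_resolution F I -> is_minimal F ->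
  is_graded F' -> is_resolution F' I ->
  betti F i j <> 0%N -> betti F' i j <> 0%N.
Proof.
move=> gF rF mF gF' rF' /eqP; rewrite -lt0n => /card_gt0P[a].
rewrite inE => /eqP sa; apply/eqP; rewrite -lt0n.
have [phi [psi [gphi _ _ [h [E [hh _ E0]]]]]] := comparison_step i gF rF mF gF' rF'.
have : const_mx0 (1%:M - phi *m psi) = 0.
  rewrite hh /const_mx0 map_mxD map_mxM /=.
  have -> : map_mx (mcoeff 0%MM) (diff F i) = 0.
    by apply/matrixP => b c; rewrite !mxE mF.
  by rewrite mulmx0 add0r.
move/matrixP/(_ a a); rewrite !mxE eqxx mulr1n mcoeffB mcoeff1 eqxx mulr1n raddf_sum /=.
move/eqP; rewrite subr_eq0 => /eqP s1.
have [b hb] : exists b, (phi a b)@_0%MM != 0.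
  apply/existsP; apply: contraT; rewrite negb_exists => /forallP z.
  have : (1 : K) == 0; last by rewrite oner_eq0.
  rewrite s1 big1 // => b _; rewrite rmorphM /=.
  by move: (z b); rewrite negbK => /eqP->; rewrite mul0r.
apply/card_gt0P; exists b; rewrite inE -sa; apply/eqP.
by rewrite -(gphi a b 0%MM) ?mcoeff_msupp // mdeg0.
Qed.

Lemma has_reg_unique r r' : has_reg I r -> has_reg I r' -> r = r'.
Proof.
move=> [F [gF rF mF [i [j [bij ->]]] maxF]] [F' [gF' rF' mF' [i' [j' [bij' ->]]] maxF']].
apply/eqP; rewrite eq_le maxF'; last exact: betti_comparison bij.
by rewrite maxF //; apply: betti_comparison bij'.
Qed.

Lemma regP r : has_reg I r -> reg I = r.
Proof.
move=> hr; apply: has_reg_unique (hr).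
exact: (ClassicalEpsilon.epsilon_spec (inhabits (0 : int)) (has_reg I) (ex_intro _ r hr)).
Qed.

End Comparison.

(** * Complexes over K labelled by sets of vertices *)

Lemma sum_neq0 (R : nmodType) (I : finType) (F : I -> R) :
  \sum_i F i != 0 -> exists i, F i != 0.
Proof.
move=> s0; apply/existsP; apply: contraNT s0.
rewrite negb_exists => /forallP z; rewrite big1 // => i _.
by apply/eqP; move: (z i); rewrite negbK.
Qed.

Lemma mulf_neq0E (R : idomainType) (x y : R) : x * y != 0 -> x != 0 /\ y != 0.
Proof. by rewrite mulf_eq0 negb_or => /andP. Qed.

Section LabelledComplexes.
Variables (K : fieldType) (V : finType).
Implicit Types (U W E : {set V}) (P : {set V} -> bool).

(* All homological degrees are put in one square matrix acting on row vectors;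
   only the indices in act are generators. The base is the generator of S in a
   resolution of S/I, so the generators of I start in degree 1. *)
Record lcomplex := LComplex {
  lsize : nat;
  act : {set 'I_lsize};
  dif : 'M[K]_lsize;
  lab : 'I_lsize -> {set V};
  hdeg : 'I_lsize -> nat;
  base : 'I_lsize
}.

(** The strand in multidegree [U]: combinations of active generators whose label divides the
    monomial of [U]. *)
Definition supported X U (v : 'rV[K]_(lsize X)) :=
  forall a, v 0 a != 0 -> (a \in act X) && (lab a \subset U).

(* P U says that the squarefree monomial with support U lies in the ideal I, and
   dif_exact is exactness of the strand of the resolution of S/I in multidegree
   U. *)
Record resolves X P := Resolves {
  base_act : base X \in act X;
  base_lab : lab (base X) = set0;
  base_hdeg : hdeg (base X) = 0%N;
  hdeg_base : forall a : 'I_(lsize X), a \in act X -> hdeg a = 0%N -> a = base X;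
  dif_neq0 : forall a b, dif X a b != 0 ->
    [/\ a \in act X, b \in act X, lab b \subset lab a & hdeg a = (hdeg b).+1];
  dif_dif : dif X *m dif X = 0;
  dif_base : forall a, dif X a (base X) != 0 -> P (lab a);
  dif_exact : forall U (v : 'rV[K]_(lsize X)), supported U v -> v *m dif X = 0 ->
    v 0 (base X) = 0 \/ P U -> exists u, supported U u /\ v = u *m dif X
}.

Lemma supportedB X U (v w : 'rV[K]_(lsize X)) :
  supported U v -> supported U w -> supported U (v - w).
Proof.
move=> sv sw a; rewrite !mxE => h.
have [v0|/sv//] := eqVneq (v 0 a) 0; apply: sw.
by apply: contraNneq h => ->; rewrite v0 subrr.
Qed.

Lemma supportedZ X U c (v : 'rV[K]_(lsize X)) :
  (c != 0 -> supported U v) -> supported U (c *: v).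
Proof. by move=> sv a; rewrite mxE => /mulf_neq0E[/sv h /h]. Qed.

Lemma supported_delta X U a : a \in act X -> lab a \subset U ->
  @supported X U (delta_mx 0 a).
Proof.
move=> aX aU b; rewrite mxE eqxx /=.
by case: (b =P a) => [->|_]; rewrite ?aX ?aU ?eqxx.
Qed.

Lemma row_dif_hdeg0 X P a : resolves X P -> hdeg a = 0%N -> row a (dif X) = 0.
Proof.
move=> rX h; apply/rowP => b; rewrite !mxE.
by apply/eqP; apply: contraTT isT => /(dif_neq0 rX)[_ _ _]; rewrite h.
Qed.

(** Multiplication by the monomial of [E] maps the quotient by the colon ideal to the quotient
    resolved by [F], and [Phi] lifts it to the resolutions. Row [a] of [Phi] lives in the strand
    [lab a :|: E], so the colon ideal is compared with the ideal of [F] on sets containing [E]. *)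
Lemma comparison_lift F G PF PG E :
  resolves F PF -> resolves G PG ->
  (forall U W, U \subset W -> PG U -> PG W) ->
  (forall U, E \subset U -> PG U = PF U) ->
  exists Phi : 'M[K]_(lsize G, lsize F),
    [/\ forall a b, Phi a b != 0 -> [/\ a \in act G, b \in act F,
          lab b \subset lab a :|: E & hdeg a = hdeg b],
        row (base G) Phi = delta_mx 0 (base F)
      & dif G *m Phi = Phi *m dif F].
Proof.
move=> rF rG monoG colon.
pose ok a (u : 'rV[K]_(lsize F)) := forall b, u 0 b != 0 ->
  [/\ a \in act G, b \in act F, lab b \subset lab a :|: E & hdeg a = hdeg b].
suff step k : exists Phi : 'M[K]_(lsize G, lsize F),
    [/\ forall a, ok a (row a Phi), row (base G) Phi = delta_mx 0 (base F)
      & forall a : 'I_(lsize G), (hdeg a <= k)%N ->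
         row a (dif G *m Phi) = row a (Phi *m dif F)].
  have [Phi [okP bP cP]] := step (\max_(a < lsize G) hdeg a).
  exists Phi; split=> // [a b|]; first by have := okP a b; rewrite mxE.
  by apply/row_matrixP => a; apply/cP/leq_bigmax.
elim: k => [|k [Phi [okP bP cP]]].
  exists (delta_mx (base G) (base F)); split.
  - move=> a b; rewrite !mxE.
    case: (a =P _) => [->|_] /=; last by rewrite eqxx.
    case: (b =P _) => [->|_] /=; last by rewrite eqxx.
    by rewrite (base_act rF) (base_act rG) (base_lab rF) sub0set
      (base_hdeg rF) (base_hdeg rG).
  - by apply/rowP => b; rewrite !mxE !eqxx.
  - move=> a; rewrite leqn0 => /eqP a0.
    rewrite !row_mul (row_dif_hdeg0 rG a0) mul0mx.
    apply/rowP => b; rewrite !mxE big1 // => c _; rewrite !mxE.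
    case: eqP => [_|]; last by rewrite mul0r.
    case: eqP => [->|]; last by rewrite mul0r.
    have /rowP/(_ b) := row_dif_hdeg0 rF (base_hdeg rF).
    by rewrite !mxE => ->; rewrite mulr0.
(* Rows up to degree [k] are kept, rows of degree [k.+1] are lifted through [dif F], and higher rows
   are zero for now. *)
have lift a : exists u, [/\ ok a u, (hdeg a <= k)%N -> u = row a Phi
    & hdeg a = k.+1 -> u *m dif F = row a (dif G *m Phi)].
  have [hak|hak|hak] := ltngtP (hdeg a) k.+1.
  - by exists (row a Phi); split=> // h; rewrite h ltnn in hak.
  - exists 0; split=> [b|h|h]; first by rewrite mxE eqxx.
      by move: hak; rewrite ltnNge ltnW.
    by rewrite h ltnn in hak.
  have [v hv] : exists v, v = row a (dif G *m Phi) by exists (row a (dif G *m Phi)).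
  have vE b : v 0 b != 0 -> exists c,
      [/\ dif G a c != 0, [/\ a \in act G, c \in act G & b \in act F], hdeg c = k,
          hdeg b = k & lab b \subset lab a :|: E].
    rewrite hv !mxE => /sum_neq0[c /mulf_neq0E[ac cb]]; exists c.
    have [aG cG ca hac] := dif_neq0 rG ac.
    have [_ bF bc hbc] : [/\ c \in act G, b \in act F, lab b \subset lab c :|: E
      & hdeg c = hdeg b] by apply: okP; rewrite mxE.
    move: hac; rewrite hak => -[hc]; split=> //; first by rewrite -hbc.
    by rewrite (subset_trans bc) // setSU.
  have [|||u [su vu]] := dif_exact rF (U := lab a :|: E) (v := v).
  - by move=> b /vE[c [_ [_ _ ->] _ _ ->]].
  - rewrite hv -row_mul -mulmxA.
    transitivity (row a (dif G *m (dif G *m Phi))); last first.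
      by rewrite mulmxA (dif_dif rG) mul0mx row0.
    apply/rowP => b; rewrite !mxE; apply: eq_bigr => c _.
    have [->|ac] := eqVneq (dif G a c) 0; first by rewrite !mul0r.
    have [_ _ _] := dif_neq0 rG ac; rewrite hak => -[hc].
    have /(congr1 (fun v : 'rV_ _ => v 0 b)) : row c (dif G *m Phi) = row c (Phi *m dif F).
      by apply: cP; rewrite -hc.
    by rewrite ![row _ _ _ _]mxE => ->.
  (* A nonzero base coordinate forces [k = 0]: row [a] then meets the base of [G], so [lab a] lies
     in the colon ideal and [lab a :|: E] in the ideal of [F]. *)
  - have [->|v0] := eqVneq (v 0 (base F)) 0; [by left|right].
    have [c [ac [aG cG _] hc hb _]] := vE _ v0.
    have cb : c = base G.
      by apply: (hdeg_base rG) => //; rewrite hc -hb (base_hdeg rF).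
    rewrite -colon ?subsetUr //; apply: monoG (subsetUl _ _) _.
    by apply: (dif_base rG); rewrite -cb.
  have [u' hu'] : exists u', u' = \row_b (if hdeg b == k.+1 then u 0 b else 0).
    by eexists.
  have vu' : v = u' *m dif F.
    apply/rowP => b; have [hb|hb] := eqVneq (hdeg b) k.
      rewrite vu !mxE; apply: eq_bigr => c _; rewrite hu' mxE.
      have [->|cb] := eqVneq (dif F c b) 0; first by rewrite !mulr0.
      by have [_ _ _ ->] := dif_neq0 rF cb; rewrite hb eqxx.
    transitivity (0 : K).
      by apply/eqP; apply: contraNT hb => /vE[c [_ _ _ -> _]].
    rewrite mxE big1 // => c _; rewrite hu' mxE.
    have [->|cb] := eqVneq (dif F c b) 0; first by rewrite mulr0.
    have [_ _ _ ->] := dif_neq0 rF cb.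
    by rewrite eqSS (negPf hb) mul0r.
  have [v0|v0] := eqVneq v 0.
    exists 0; split=> [b|h|_]; first by rewrite mxE eqxx.
      by rewrite hak ltnn in h.
    by rewrite mul0mx -hv v0.
  exists u'; split=> [b|h|_]; last by rewrite -vu'.
    rewrite hu' mxE; case: (hdeg b =P _) => [hb|]; last by rewrite eqxx.
    move=> /su /andP[-> ->]; rewrite hb hak; split=> //.
    have [b' b'0] : exists b', v 0 b' != 0.
      apply/existsP; apply: contraNT v0; rewrite negb_exists => /forallP z.
      by apply/eqP/rowP => b'; rewrite [RHS]mxE; apply/eqP; move: (z b'); rewrite negbK.
    by have [c [_ []]] := vE _ b'0.
  by rewrite hak ltnn in h.
have /fin_all_exists[u hu] := lift.
exists (\matrix_a u a); split.
- by move=> a; rewrite rowK; have [] := hu a.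
- by rewrite rowK; have [_ -> //] := hu (base G); rewrite (base_hdeg rG).
move=> a ha.
have -> : row a (dif G *m \matrix_a u a) = row a (dif G *m Phi).
  apply/rowP => b; rewrite !mxE; apply: eq_bigr => c _.
  have [->|ac] := eqVneq (dif G a c) 0; first by rewrite !mul0r.
  have [_ _ _ hac] := dif_neq0 rG ac.
  have hc : (hdeg c <= k)%N by rewrite -ltnS -hac.
  by rewrite mxE; have [_ /(_ hc) -> _] := hu c; rewrite mxE.
rewrite [RHS]row_mul rowK; have [_ h1 h2] := hu a.
move: ha; rewrite leq_eqVlt => /orP[/eqP/h2 -> //|].
by rewrite ltnS => ha; rewrite h1 // cP // row_mul.
Qed.

End LabelledComplexes.

(** * Mapping cones and cancellation of labelled complexes *)

Section MappingCone.
Variables (K : fieldType) (V : finType).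
Implicit Types (U W E : {set V}) (P : {set V} -> bool).
Local Notation lcomplex := (lcomplex K V).

Definition sumcase m n T (f : 'I_m -> T) (g : 'I_n -> T) (a : 'I_(m + n)) : T :=
  match split a with inl i => f i | inr j => g j end.

Lemma sumcase_l m n T (f : 'I_m -> T) (g : 'I_n -> T) i :
  sumcase f g (lshift n i) = f i.
Proof. by rewrite /sumcase -[lshift n i]/(unsplit (inl i)) unsplitK. Qed.

Lemma sumcase_r m n T (f : 'I_m -> T) (g : 'I_n -> T) j :
  sumcase f g (rshift m j) = g j.
Proof. by rewrite /sumcase -[rshift m j]/(unsplit (inr j)) unsplitK. Qed.

Definition sumcaseE := (sumcase_l, sumcase_r).

(** The mapping cone of [Phi], acting on rows [(v, u)] with the [G] part [u] one degree higher.
    Joining [E] to the labels of [G] is the multidegree shift of multiplication by [E]; the sign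
    makes the square zero. *)
Definition cone (F G : lcomplex) E (Phi : 'M[K]_(lsize G, lsize F)) : lcomplex :=
  LComplex [set a | sumcase (fun i => i \in act F) (fun j => j \in act G) a]
    (block_mx (dif F) 0 Phi (- dif G))
    (sumcase (@lab _ _ F) (fun j => lab j :|: E))
    (sumcase (@hdeg _ _ F) (fun j => (hdeg j).+1))
    (lshift (lsize G) (base F)).

(** With [J] the ideal of [F] and [e] the monomial of [E], this is the short exact sequence of
    [S/(J : e)], [S/J] and [S/(J + e)] at the level of resolutions. *)
Lemma cone_resolves (F G : lcomplex) PF PG E (Phi : 'M[K]_(lsize G, lsize F)) :
  resolves F PF -> resolves G PG ->
  (forall U W, U \subset W -> PF U -> PF W) ->
  (forall U, E \subset U -> PG U = PF U) ->
  (forall a b, Phi a b != 0 -> [/\ a \in act G, b \in act F,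
     lab b \subset lab a :|: E & hdeg a = hdeg b]) ->
  row (base G) Phi = delta_mx 0 (base F) ->
  dif G *m Phi = Phi *m dif F ->
  resolves (cone E Phi) (fun U => PF U || (E \subset U)).
Proof.
move=> rF rG monoF colon hPhi bPhi cPhi.
have Phi_base a : Phi a (base F) != 0 -> a = base G.
  by move=> /hPhi[aG _ _ ha]; apply: (hdeg_base rG); rewrite // ha (base_hdeg rF).
split=> /=.
- by rewrite inE sumcaseE (base_act rF).
- by rewrite sumcaseE (base_lab rF).
- by rewrite sumcaseE (base_hdeg rF).
- move=> a; case: (split_ordP a) => [i ->|j ->]; rewrite inE !sumcaseE //.
  by move=> iF hi; rewrite (hdeg_base rF iF hi).
- move=> a b; case: (split_ordP a) => [i ->|i ->];
    case: (split_ordP b) => [j ->|j ->];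
    rewrite !inE !sumcaseE ?block_mxEul ?block_mxEur ?block_mxEdl ?block_mxEdr.
  + exact: (dif_neq0 rF).
  + by rewrite mxE eqxx.
  + by move=> /hPhi[-> -> -> ->].
  + rewrite mxE oppr_eq0 => /(dif_neq0 rG)[-> -> ij ->].
    by rewrite setSU.
- rewrite mulmx_block !mul0mx !mulmx0 !addr0 (dif_dif rF) mulNmx -cPhi subrr.
  by rewrite mulNmx mulmxN opprK (dif_dif rG) add0r block_mx0.
- move=> a; case: (split_ordP a) => [i ->|i ->];
    rewrite sumcaseE ?block_mxEul ?block_mxEdl.
    by move=> /(dif_base rF)->.
  by move=> _; rewrite subsetUr orbT.
move=> U v; rewrite -[v]hsubmxK; move: (lsubmx v) (rsubmx v) => {}v u sx.
rewrite mul_row_block mulmx0 add0r mulmxN -row_mx0 => /eq_row_mx[vu0 /eqP].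
rewrite oppr_eq0 row_mxEl => /eqP uG hv.
have sv : @supported _ _ F U v.
  by move=> a va; have := sx (lshift _ a); rewrite row_mxEl /= inE !sumcaseE => /(_ va).
have su a : u 0 a != 0 -> (a \in act G) && (lab a :|: E \subset U).
  by move=> va; have := sx (rshift _ a); rewrite row_mxEr /= inE !sumcaseE => /(_ va).
(* Unless [E] is inside [U], the strand has no part from [G], and exactness of [F] is enough. *)
have [EU|EU] := boolP (E \subset U); last first.
  have u0 : u = 0.
    apply/rowP => a; rewrite [RHS]mxE; apply/eqP; apply: contraNT EU => /su.
    by rewrite subUset => /and3P[].
  move: vu0; rewrite u0 mul0mx addr0 => vF0.
  have [|s [ss vs]] := dif_exact rF sv vF0.
    by case: hv => [->|]; [left|rewrite (negPf EU) orbF; right].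
  exists (row_mx s 0); split.
    move=> a; case: (split_ordP a) => [i ->|i ->]; rewrite ?row_mxEl ?row_mxEr.
      by move=> /ss; rewrite /= inE !sumcaseE.
    by rewrite mxE eqxx.
  by rewrite mul_row_block !mul0mx mulmx0 !addr0 vs.
have suG : @supported _ _ G U u.
  by move=> a /su/andP[->]; rewrite subUset => /andP[].
have [|t [st ut]] := dif_exact rG suG uG.
  (* A base coordinate of [u] is carried by [Phi] to [base F], where the boundary of [v] must cancel
     it; so the label of some generator reaching [base F] is contained in [U]. *)
  have [->|u0] := eqVneq (u 0 (base G)) 0; [by left|right].
  rewrite colon //.
  have : (v *m dif F) 0 (base F) != 0.
    move/matrixP/(_ 0 (base F)): (vu0); rewrite mxE [RHS]mxE => /eqP.
    rewrite addr_eq0 => /eqP->; rewrite oppr_eq0.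
    rewrite mxE (bigD1 (base G)) //= big1 => [|c cG].
      move/matrixP/(_ 0 (base F)): (bPhi).
      by rewrite !mxE !eqxx => ->; rewrite addr0 mulr1.
    apply/eqP; rewrite mulf_eq0; apply/orP; right; apply: contraNT cG.
    by move=> /Phi_base->.
  rewrite mxE => /sum_neq0[c /mulf_neq0E[vc cb]].
  by apply: monoF (dif_base rF cb); have /andP[] := sv _ vc.
(* The remaining base coordinate [g] is subtracted to make [dif_exact] applicable, and restored
   through [base G], which [Phi] sends to [base F]. *)
pose g := (v + t *m Phi) 0 (base F).
have [|||s [ss vs]] := dif_exact rF (U := U) (v := v + t *m Phi - g *: delta_mx 0 (base F)).
- apply: supportedB; last first.
    apply: supportedZ => _; apply: supported_delta; first exact: (base_act rF).
    by rewrite (base_lab rF) sub0set.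
  rewrite -[t *m Phi]opprK; apply: supportedB => // a.
  rewrite mxE oppr_eq0 mxE => /sum_neq0[c /mulf_neq0E[tc /hPhi[_ -> ca _]]].
  rewrite (subset_trans ca) // subUset EU andbT.
  by have /andP[] := st _ tc.
- rewrite mulmxBl mulmxDl -mulmxA -cPhi mulmxA -ut vu0 sub0r -scalemxAl.
  by rewrite -rowE (row_dif_hdeg0 rF (base_hdeg rF)) scaler0 oppr0.
- by left; rewrite mxE -/g !mxE !eqxx mulr1 subrr.
exists (row_mx s (g *: delta_mx 0 (base G) - t)); split.
  move=> a; case: (split_ordP a) => [i ->|i ->]; rewrite ?row_mxEl ?row_mxEr.
    by move=> /ss; rewrite /= inE !sumcaseE.
  rewrite /= inE !sumcaseE subUset EU andbT.
  apply: supportedB st _; apply: supportedZ => _.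
  apply: supported_delta; first exact: (base_act rG).
  by rewrite (base_lab rG) sub0set.
rewrite mul_row_block mulmx0 add0r mulmxN -vs !mulmxBl -!scalemxAl -!rowE bPhi.
rewrite (row_dif_hdeg0 rG (base_hdeg rG)) scaler0 sub0r opprK -ut.
by rewrite addrA subrK addrK.
Qed.

Lemma cone_exists (F G : lcomplex) PF PG E :
  resolves F PF -> resolves G PG ->
  (forall U W, U \subset W -> PF U -> PF W) ->
  (forall U W, U \subset W -> PG U -> PG W) ->
  (forall U, E \subset U -> PG U = PF U) ->
  exists Phi, resolves (cone (F := F) (G := G) E Phi) (fun U => PF U || (E \subset U)).
Proof.
move=> rF rG monoF monoG colon.
have [Phi [h1 h2 h3]] := comparison_lift rF rG monoG colon.
by exists Phi; apply: (cone_resolves rF rG).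
Qed.

(** The resolution for the zero ideal, from which all cones below start. *)
Definition trivial_lcomplex : lcomplex :=
  LComplex [set: 'I_1] 0 (fun _ => set0) (fun _ => 0%N) ord0.

Lemma trivial_resolves : resolves trivial_lcomplex (fun _ => false).
Proof.
split=> //=; rewrite ?inE ?mulmx0 //.
- by move=> a _ _; rewrite ord1.
- by move=> a b; rewrite mxE eqxx.
- by move=> a; rewrite mxE eqxx.
- move=> U v _ _ [v0|//]; exists 0; split; first by move=> a; rewrite mxE eqxx.
  by rewrite mul0mx; apply/rowP => a; rewrite ord1 v0 mxE.
Qed.

(* Two generators p, q with equal labels and a nonzero entry at (p, q) are
   removed by passing to the quotient by the acyclic subcomplex spanned by e_p
   and its boundary: cancel_shear kills the e_q coordinate by subtracting a
   multiple of the boundary of e_p, cancel_mask kills the e_p coordinate. *)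
Section Cancellation.
Variables (X : lcomplex) (P : {set V} -> bool) (p q : 'I_(lsize X)).
Hypotheses (rX : resolves X P) (P0 : ~~ P set0).
Hypotheses (pq : dif X p q != 0) (labpq : lab p = lab q).

Definition cancel_mask : 'M[K]_(lsize X) :=
  \matrix_(a, b) ((a == b) && (b != p) && (b != q))%:R.

Definition cancel_shear : 'M[K]_(lsize X) :=
  1%:M - (dif X p q)^-1 *: (delta_mx q p *m dif X).

Definition cancel_dif : 'M[K]_(lsize X) :=
  cancel_mask *m dif X *m (cancel_shear *m cancel_mask).

Definition cancel_pair : lcomplex :=
  LComplex (act X :\ p :\ q) cancel_dif (@lab _ _ X) (@hdeg _ _ X) (base X).

Local Notation C := (dif X).
Local Notation c := (dif X p q).

Lemma mul_cancel_mask m (A : 'M[K]_(m, lsize X)) a b :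
  (A *m cancel_mask) a b = if (b != p) && (b != q) then A a b else 0.
Proof.
rewrite mxE (bigD1 b) //= big1 => [|d db]; last by rewrite mxE (negPf db) mulr0.
by rewrite mxE eqxx addr0; case: ifP; rewrite ?mulr1 ?mulr0.
Qed.

Lemma cancel_mask_mul m (A : 'M[K]_(lsize X, m)) a b :
  (cancel_mask *m A) a b = if (a != p) && (a != q) then A a b else 0.
Proof.
rewrite mxE (bigD1 a) //= big1 => [|d db]; last by rewrite mxE eq_sym (negPf db) mul0r.
by rewrite mxE eqxx addr0; case: ifP; rewrite ?mul1r ?mul0r.
Qed.

Lemma mul_cancel_shear (v : 'rV[K]_(lsize X)) :
  v *m cancel_shear = v - (c^-1 * v 0 q) *: (delta_mx 0 p *m C).
Proof.
rewrite mulmxBr mulmx1 -scalemxAr mulmxA.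
suff -> : v *m delta_mx q p = v 0 q *: delta_mx 0 p by rewrite -scalemxAl scalerA.
apply/rowP => b; rewrite !mxE (bigD1 q) //= big1 => [|d db]; rewrite !mxE ?eqxx ?addr0 //.
by rewrite (negPf db) mulr0.
Qed.

Lemma mul_cancel_shear_q (v : 'rV[K]_(lsize X)) : (v *m cancel_shear) 0 q = 0.
Proof.
by rewrite mul_cancel_shear -rowE !mxE mulrAC mulVf // mul1r subrr.
Qed.

Lemma mul_cancel_mask_q (v : 'rV[K]_(lsize X)) :
  v 0 q = 0 -> v *m cancel_mask = v - v 0 p *: delta_mx 0 p.
Proof.
move=> vq; apply/rowP => b; rewrite mul_cancel_mask !mxE eqxx /=.
have [->|bp] := eqVneq b p; first by rewrite mulr1 subrr.
by rewrite mulr0 subr0; have [->|] := eqVneq b q; rewrite ?vq.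
Qed.

Lemma boundary_cancel : delta_mx 0 p *m C *m cancel_shear = 0 :> 'rV_ _.
Proof.
by rewrite mul_cancel_shear -rowE mxE mulVf // scale1r subrr.
Qed.

(** The projection [cancel_shear *m cancel_mask] is a chain map: after the shear, the mask removes
    only a multiple of [e_p], whose boundary the shear kills, and the shear itself subtracts a
    boundary. *)
Lemma cancel_difE (v : 'rV[K]_(lsize X)) :
  v *m (cancel_shear *m cancel_mask) *m cancel_dif =
  v *m C *m (cancel_shear *m cancel_mask).
Proof.
have MM : cancel_mask *m cancel_mask = cancel_mask.
  apply/matrixP => a b; rewrite mul_cancel_mask.
  by case: ifP => // h; rewrite mxE -andbA h andbF.
have -> : v *m (cancel_shear *m cancel_mask) *m cancel_dif =
    (v *m cancel_shear *m cancel_mask) *m C *m (cancel_shear *m cancel_mask).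
  by rewrite /cancel_dif !mulmxA -[X in X *m C]mulmxA MM.
rewrite (mul_cancel_mask_q (mul_cancel_shear_q v)) !mulmxA.
rewrite mulmxBl mulmxBl -!scalemxAl boundary_cancel scaler0 subr0.
rewrite mul_cancel_shear mulmxBl -scalemxAl -(mulmxA (delta_mx _ _)) (dif_dif rX).
by rewrite mulmx0 scaler0 subr0.
Qed.

(** Off [p] and [q] the new matrix is the Schur complement [C a b - c^-1 * C a q * C p b]. *)
Lemma cancel_dif_neq0 a b : cancel_dif a b != 0 ->
  [/\ a != p, a != q, b != p, b != q & C a b != 0 \/ C a q != 0 /\ C p b != 0].
Proof.
rewrite /cancel_dif mulmxA mul_cancel_mask -(mulmxA _ C) cancel_mask_mul.
case: ifP => [/andP[-> ->]|]; last by rewrite eqxx.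
case: ifP => [/andP[-> ->]|]; last by rewrite eqxx.
have -> : (C *m cancel_shear) a b = C a b - c^-1 * C a q * C p b.
  transitivity ((row a C *m cancel_shear) 0 b); first by rewrite -row_mul [RHS]mxE.
  by rewrite mul_cancel_shear -rowE !mxE.
move=> h; split=> //.
have [ab|] := eqVneq (C a b) 0; [right|by left].
by move: h; rewrite ab sub0r oppr_eq0 => /mulf_neq0E[/mulf_neq0E[]].
Qed.

Lemma cancel_resolves : (forall U W, U \subset W -> P U -> P W) ->
  resolves cancel_pair P.
Proof.
move=> monoP; have [pX qX _ hpq] := dif_neq0 rX pq.
have bp : base X != p by apply/eqP => bp; move: hpq; rewrite -bp (base_hdeg rX).
(* The base cannot be [q]: the entry at [p] would then put the empty label of [p] in the ideal. *)
have bq : base X != q.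
  apply: contraNneq P0 => bq; rewrite -(base_lab rX) bq -labpq.
  by apply: (dif_base rX); rewrite bq.
have Cpp : C p p = 0.
  apply/eqP; apply: contraTT isT => /(dif_neq0 rX)[_ _ _ /eqP].
  by rewrite -[X in X == _]addn0 -addn1 eqn_add2l.
split=> /=.
- by rewrite !inE bp bq (base_act rX).
- exact: base_lab rX.
- exact: base_hdeg rX.
- by move=> a /setD1P[_ /setD1P[_ aX]]; apply: (hdeg_base rX).
- move=> a b /cancel_dif_neq0[ap aq bp' bq' ab]; rewrite !inE ap aq bp' bq' /=.
  case: ab => [/(dif_neq0 rX)[-> -> -> ->]//|[aq' pb]].
  have [-> _ qa ->] := dif_neq0 rX aq'; have [_ -> bp'' hp] := dif_neq0 rX pb.
  by rewrite -hp hpq; split=> //; apply: subset_trans bp'' _; rewrite labpq.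
- apply/row_matrixP => a; rewrite row0 row_mul [in X in X *m _]/cancel_dif.
  rewrite row_mul cancel_difE -row_mul -(mulmxA cancel_mask) (dif_dif rX).
  by rewrite mulmx0 row0 mul0mx.
- move=> a /cancel_dif_neq0[_ _ _ _ [/(dif_base rX)//|[aq /(dif_base rX)]]].
  by rewrite labpq; apply: monoP; have [] := dif_neq0 rX aq.
move=> U v sv vC hv.
have vM : v *m cancel_mask = v.
  apply/rowP => b; rewrite mul_cancel_mask; case: ifP => // h.
  apply/esym/eqP; apply: contraFT h => /sv.
  by rewrite !inE => /andP[/and3P[-> ->]].
have vp : v 0 p = 0 by rewrite -vM mul_cancel_mask eqxx.
have vq : v 0 q = 0 by rewrite -vM mul_cancel_mask eqxx andbF.
have svX : @supported _ _ X U v.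
  by move=> a /sv; rewrite !inE => /andP[/and3P[_ _ ->]].
pose w := v *m C *m cancel_shear.
have wq : w 0 q = 0 by apply: mul_cancel_shear_q.
have wE : w = w 0 p *: delta_mx 0 p.
  apply/eqP; rewrite -subr_eq0 -mul_cancel_mask_q // /w.
  by rewrite -(mulmxA (v *m C)) -[v in v *m C]vM -mulmxA -!mulmxA; move: vC; rewrite /cancel_dif !mulmxA => ->.
(* Subtracting [g] times [e_p] kills the [q] coordinate of the boundary of [v]. What is left is a
   multiple of [e_p], and the multiple vanishes because its own boundary is zero while [c] is
   not. *)
pose g := c^-1 * (v *m C) 0 q.
pose v' := v - g *: delta_mx 0 p.
have v'C : v' *m C = w 0 p *: delta_mx 0 p.
  by rewrite -wE /w mul_cancel_shear mulmxBl -scalemxAl.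
have wp : w 0 p = 0.
  have : v' *m C *m C = 0 by rewrite -mulmxA (dif_dif rX) mulmx0.
  rewrite v'C -scalemxAl -rowE => /matrixP/(_ 0 q)/eqP.
  by rewrite !mxE mulf_eq0 (negPf pq) orbF => /eqP.
have [|||u [su v'u]] := dif_exact rX (U := U) (v := v').
- apply: supportedB => //; apply: supportedZ => g0; apply: supported_delta => //.
  have : (v *m C) 0 q != 0 by apply: contraNneq g0; rewrite /g => ->; rewrite mulr0.
  rewrite mxE => /sum_neq0[a /mulf_neq0E[va aq]].
  have [_ _ qa _] := dif_neq0 rX aq; have /andP[_ aU] := svX _ va.
  by rewrite labpq (subset_trans qa).
- by rewrite v'C wp scale0r.
- by case: hv => [vb|]; [left|right]; rewrite // !mxE eqxx (negPf bp) mulr0 subr0.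
exists (u *m (cancel_shear *m cancel_mask)); split; last first.
  rewrite cancel_difE -v'u mulmxBl -scalemxAl mulmxA mul_cancel_shear vq mulr0.
  rewrite scale0r subr0 vM.
  suff -> : delta_mx 0 p *m (cancel_shear *m cancel_mask) = 0 :> 'rV_ _.
    by rewrite scaler0 subr0.
  rewrite mulmxA mul_cancel_shear mxE eqxx /=.
  have /negPf-> : q != p by apply: contraNneq pq => ->; rewrite Cpp.
  rewrite mulr0 scale0r subr0.
  by apply/rowP => b; rewrite mul_cancel_mask !mxE; case: eqP => //=; rewrite if_same.
move=> a; rewrite mulmxA mul_cancel_mask /= !inE.
case: ifP => [/andP[-> ->] /=|]; last by rewrite eqxx.
rewrite mul_cancel_shear -rowE; apply: supportedB => //.
apply: supportedZ => /mulf_neq0E[_ /su/andP[_ qU]] b; rewrite mxE.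
by move=> /(dif_neq0 rX)[_ -> bp' _]; rewrite (subset_trans bp') ?labpq.
Qed.

End Cancellation.

End MappingCone.

(** * Minimalization, and labelled resolutions of paths and cycles *)

Section MinimalAndCycles.
Variables (K : fieldType) (V : finType).
Implicit Types (U W E : {set V}) (P : {set V} -> bool).
Local Notation lcomplex := (lcomplex K V).

(** Cancellation is repeated until every nonzero entry changes the label. Since [dif] lowers the
    degree by one and all generators labelled [A] share a degree, no cancelled pair has label
    [A]. *)
Lemma minimal_lcomplex (X : lcomplex) P A :
  resolves X P -> ~~ P set0 -> (forall U W, U \subset W -> P U -> P W) ->
  (forall a b, a \in act X -> b \in act X -> lab a = A -> lab b = A ->
     hdeg a = hdeg b) ->
  (exists2 a, a \in act X & lab a = A) ->
  exists Y : lcomplex,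
    [/\ resolves Y P, forall a b, dif Y a b != 0 -> lab a != lab b,
        forall b, b \in act Y -> exists2 a, a \in act X &
          lab a = lab b /\ hdeg a = hdeg b
      & exists2 b, b \in act Y & lab b = A].
Proof.
move=> rX P0 monoP; have [k] := ubnP #|act X|.
elim: k X rX => // k IH X rX Xk hA exA.
have [/existsP[p /existsP[q /andP[pq /eqP labpq]]]|nopq] :=
  boolP [exists p, exists q, (dif X p q != 0) && (lab p == lab q)]; last first.
  exists X; split=> // [a b ab|b bX]; last by exists b.
  apply/negP => lab_ab; move/negP: nopq; apply.
  by apply/existsP; exists a; apply/existsP; exists b; rewrite ab.
have [pX qX _ hpq] := dif_neq0 rX pq.
have subX a : a \in act (cancel_pair p q) -> a \in act X.
  by rewrite !inE => /and3P[].
have [|a b /subX aX /subX bX||Y [rY minY subY exY]] :=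
  IH (cancel_pair p q) (cancel_resolves rX P0 pq labpq monoP).
- move: Xk; rewrite ltnS; apply: leq_trans.
  by apply: proper_card; apply/properP; split; [apply/subsetP|exists p]; rewrite // !inE eqxx ?andbF.
- exact: hA.
- have [a aX aA] := exA; exists a => //; rewrite !inE aX andbT.
  have neq : lab p = A -> lab q = A -> False.
    by move=> /(hA _ _ pX qX) h /h; lia.
  by apply/andP; split; apply/eqP => e; apply: neq; rewrite ?labpq -?aA ?e // -labpq.
exists Y; split=> // b /subY[a /subX aX ?].
by exists a.
Qed.

Lemma resolves_ext (X : lcomplex) P Q : P =1 Q -> resolves X P -> resolves X Q.
Proof.
by move=> PQ [*]; split=> // [a|U v sv vC]; rewrite -PQ; auto.
Qed.

(** The squarefree monomials in the edge ideal of the path [p 0, ..., p m.-1] on [m] vertices. *)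
Definition has_path_edge (p : nat -> V) m U : bool :=
  has (fun j => (p j \in U) && (p j.+1 \in U)) (iota 0 m.-1).

Lemma has_path_edgeP (p : nat -> V) m U :
  reflect (exists j, [/\ (j.+1 < m)%N, p j \in U & p j.+1 \in U])
    (has_path_edge p m U).
Proof.
apply: (iffP hasP) => [[j]|[j [jm pj pj1]]].
  rewrite mem_iota => /= jm /andP[pj pj1]; exists j; split=> //.
  by move: jm; clear; case: m; lia.
by exists j; rewrite ?mem_iota ?pj //; lia.
Qed.

Lemma has_path_edge_mono p m U W : U \subset W ->
  has_path_edge p m U -> has_path_edge p m W.
Proof.
move=> /subsetP UW /has_path_edgeP[j [jm pj pj1]]; apply/has_path_edgeP.
by exists j; rewrite jm !UW.
Qed.

Lemma mono_or P E : (forall U W, U \subset W -> P U -> P W) ->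
  forall U W, U \subset W -> P U || (E \subset U) -> P W || (E \subset W).
Proof.
move=> mP U W UW /orP[/(mP _ _ UW)->//|/subset_trans->//]; exact: orbT.
Qed.

(* Full labels sit in a single homological degree, where they realise the
   extremal value of #|lab a| - hdeg a. *)
Record path_resolution (p : nat -> V) m (X : lcomplex) : Prop := PathResolution {
  path_resolves : resolves X (has_path_edge p m);
  path_lab : forall a x, a \in act X -> x \in lab a -> exists2 j, (j < m)%N & x = p j;
  path_bound : forall a, a \in act X -> (#|lab a| <= hdeg a + m.+1 %/ 3)%N;
  path_full : forall a, a \in act X -> (forall j, (j < m)%N -> p j \in lab a) ->
    (m %% 3 <> 1)%N /\ (hdeg a + m.+1 %/ 3 = m)%N;
  path_full_exists : (m %% 3 <> 1)%N ->
    exists2 a, a \in act X & forall j, (j < m)%N -> p j \in lab a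
}.

Lemma card_setU1_le (A : {set V}) x k : (#|A| <= k)%N -> (#|A :|: [set x]| <= k.+1)%N.
Proof.
by move=> Ak; rewrite (leq_trans (leq_card_setU _ _)) // cards1 addn1 ltnS.
Qed.

Lemma card_setU2_le (A : {set V}) x y k :
  (#|A| <= k)%N -> (#|A :|: [set x; y]| <= k.+2)%N.
Proof. by move=> Ak; rewrite setUA; do 2!apply: card_setU1_le. Qed.

(** From [m] to [m.+3] vertices, the full label arises only in the copy of [G] shifted by two cones:
    three vertices are added, the degree rises by two, and [m.+1 %/ 3] rises by one. *)
Lemma path_resolution_exists (p : nat -> V) m :
  (forall i j, (i < m)%N -> (j < m)%N -> p i = p j -> i = j) ->
  exists X, path_resolution p m X.
Proof.
have triv := trivial_resolves K V.
have [k] := ubnP m; elim: k m => // k IH [|[|[|m]]] mk injp.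
- exists (trivial_lcomplex K V); split=> /=.
  + by apply: resolves_ext triv => U.
  + by move=> a x _; rewrite inE.
  + by move=> a _; rewrite cards0.
  + by [].
  + by exists ord0; rewrite ?inE.
- exists (trivial_lcomplex K V); split=> /=.
  + by apply: resolves_ext triv => U.
  + by move=> a x _; rewrite inE.
  + by move=> a _; rewrite cards0.
  + by move=> a _ /(_ 0%N isT); rewrite inE.
  + by [].
- have [//|//|//|Phi rX] := @cone_exists K V _ _ _ _ [set p 0%N; p 1%N] triv triv.
  exists (cone [set p 0%N; p 1%N] Phi); split.
  + apply: resolves_ext rX => U.
    by rewrite /has_path_edge /= subUset !sub1set orbF.
  + move=> a x; case: (split_ordP a) => [i ->|i ->] /=; rewrite !sumcaseE ?set0U !inE //.
    by move=> _ /orP[/eqP->|/eqP->]; [exists 0%N|exists 1%N].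
  + move=> a _; case: (split_ordP a) => [i ->|i ->] /=; rewrite !sumcaseE ?cards0 //.
    by rewrite set0U cards2; case: (_ != _).
  + move=> a _; case: (split_ordP a) => [i ->|i ->] /=; rewrite !sumcaseE //.
    by move=> /(_ 0%N isT); rewrite inE.
  + move=> _; exists (rshift _ ord0); rewrite /= ?inE ?sumcaseE ?inE // => j.
    by case: j => [|[|]] //; rewrite !inE eqxx ?orbT.
have [||F [rF labF bF fF eF]] := IH m.+2; first by lia.
  by move=> i j im jm; apply: injp; lia.
have [||G [rG labG bG fG eG]] := IH m; first by lia.
  by move=> i j im jm; apply: injp; lia.
(* The vertex [p m] is off the path [p 0, ..., p m.-1], so the colon by this variable is the path
   ideal again and [G] serves twice. *)
have [|||Phi1 rG1] := cone_exists rG rG (E := [set p m]); try exact: has_path_edge_mono.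
  by [].
have [|||Phi rX] := cone_exists rF rG1 (E := [set p m.+1; p m.+2]).
- exact: has_path_edge_mono.
- exact/mono_or/has_path_edge_mono.
(* With [p m.+1] in [U], its edge to [p m] amounts to the variable [p m], which also absorbs the
   edge before it. *)
- move=> U; rewrite subUset !sub1set => /andP[pm1 pm2].
  apply/orP/has_path_edgeP => [[/has_path_edgeP[j [jm pj pj1]]|pm]|[j [jm pj pj1]]].
  + by exists j; split=> //; lia.
  + by exists m.
  + have [jm'|jm'] := eqVneq j m; first by right; rewrite -jm'.
    have [jm''|jm''] := eqVneq j.+1 m; first by right; rewrite -jm''.
    by left; apply/has_path_edgeP; exists j; split=> //; lia.
exists (cone [set p m.+1; p m.+2] Phi); split.
- apply: resolves_ext rX => U; rewrite subUset !sub1set.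
  apply/orP/has_path_edgeP => [[/has_path_edgeP[j [jm pj pj1]]|/andP[pm1 pm2]]|[j [jm pj pj1]]].
  + by exists j; split=> //; lia.
  + by exists m.+1.
  + have [jm'|jm'] := eqVneq j m.+1; first by right; rewrite -jm' pj pj1.
    by left; apply/has_path_edgeP; exists j; split=> //; lia.
- move=> a x; case: (split_ordP a) => [i ->|i ->] /=; rewrite inE !sumcaseE.
    by move=> iF /(labF _ _ iF)[j jm ->]; exists j => //; lia.
  rewrite !inE; case: (split_ordP i) => [c ->|c ->]; rewrite !sumcaseE ?inE => cG.
    case/or3P => [/(labG _ _ cG)[j jm ->]|/eqP->|/eqP->]; [exists j|exists m.+1|exists m.+2] => //; lia.
  case/or3P => [/orP[/(labG _ _ cG)[j jm ->]|/eqP->]|/eqP->|/eqP->];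
    [exists j|exists m|exists m.+1|exists m.+2] => //; lia.
- move=> a; case: (split_ordP a) => [i ->|i ->] /=; rewrite inE !sumcaseE.
    by move=> /bF h; lia.
  rewrite !inE; case: (split_ordP i) => [c ->|c ->]; rewrite !sumcaseE => /bG h.
    by apply: leq_trans (card_setU2_le _ _ h) _; lia.
  by apply: leq_trans (card_setU2_le _ _ (card_setU1_le _ h)) _; lia.
(* The copy of [F] misses [p m.+2] and the first copy of [G] misses [p m], so only the second copy
   of [G] can carry all vertices. *)
- move=> a; case: (split_ordP a) => [i ->|i ->] /=; rewrite inE !sumcaseE.
    move=> iF /(_ m.+2 (leqnn _))/(labF _ _ iF)[j jm /injp jE].
    by have := jE (leqnn _) (ltnW jm); lia.
  rewrite !inE; case: (split_ordP i) => [c ->|c ->]; rewrite !sumcaseE => cG full.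
    have := full m (ltnW (leqnSn _)).
    rewrite !inE => /or3P[/(labG _ _ cG)[j jm /injp jE]|/eqP/injp jE|/eqP/injp jE].
    + by have := jE; lia.
    + by have := jE; lia.
    + by have := jE; lia.
  have [|] := fG _ cG; last by lia.
  move=> j jm; have jm3 : (j < m.+3)%N by lia.
  have := full j jm3; rewrite !inE => /or3P[/orP[//|]|/eqP/injp jE|/eqP/injp jE].
  + by move=> /eqP/injp jE; have := jE; lia.
  + by have := jE; lia.
  + by have := jE; lia.
- move=> m3; have [|c cG full] := eG; first by lia.
  exists (rshift _ (rshift _ c)); rewrite /= ?inE !sumcaseE ?inE ?sumcaseE //.
  move=> j jm; rewrite !inE; case: (ltngtP j m) => [/full->//|mj|->]; last by rewrite eqxx orbT.
  have [->|jm1] := eqVneq j m.+1; first by rewrite eqxx !orbT.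
  have -> : j = m.+2 by lia.
  by rewrite eqxx !orbT.
Qed.

(** This is the colon of the path ideal by the closing edge: beside each end in [U], the neighbour
    alone completes an edge. *)
Lemma path_cat_edges (p : nat -> V) m U : p 0%N \in U -> p m.+3 \in U ->
  has_path_edge p m.+4 U =
  has_path_edge (fun j => p j.+2) m U || (p 1%N \in U) || (p m.+2 \in U).
Proof.
move=> p0 pm3.
apply/has_path_edgeP/idP => [[j [jm pj pj1]]|/orP[/orP[/has_path_edgeP[j [jm pj pj1]]|p1]|pm2]].
- case: j jm pj pj1 => [|[|j]] jm pj pj1; rewrite ?pj ?pj1 ?orbT //.
  have [jm1|jm1] := eqVneq j m; first by rewrite -jm1 pj orbT.
  have [jm2|jm2] := eqVneq j.+1 m; first by rewrite -jm2 pj1 orbT.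
  suff -> : has_path_edge (fun j => p j.+2) m U by [].
  by apply/has_path_edgeP; exists j; split=> //; lia.
- by exists j.+2; split=> //; lia.
- by exists 0%N.
- by exists m.+2.
Qed.

(** The cycle is the path with its two ends joined. For [n] equal to 0 or 1 modulo 3, [n %/ 3] is
    the regularity of the quotient by the cycle ideal. *)
Record cycle_resolution (p : nat -> V) n (X : lcomplex) : Prop := CycleResolution {
  cycle_resolves : resolves X
    (fun U => has_path_edge p n U || ([set p 0%N; p n.-1] \subset U));
  cycle_bound : forall a, a \in act X -> (#|lab a| <= hdeg a + n %/ 3)%N;
  cycle_full : forall a, a \in act X -> (forall j, (j < n)%N -> p j \in lab a) ->
    (hdeg a + n %/ 3 = n)%N;
  cycle_full_exists :
    exists2 a, a \in act X & forall j, (j < n)%N -> p j \in lab a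
}.

(** The closing edge is added to the path by one more cone. Full labels come from the path when [n]
    is 0 modulo 3 and from the colon part when [n] is 0 or 1, always in degree [n - n %/ 3]. *)
Lemma cycle_resolution_exists (p : nat -> V) n : (2 < n)%N -> (n %% 3 <> 2)%N ->
  (forall i j, (i < n)%N -> (j < n)%N -> p i = p j -> i = j) ->
  exists X, cycle_resolution p n X.
Proof.
move=> n2 n3 injp; have [F [rF labF bF fF eF]] := path_resolution_exists injp.
case: n n2 n3 injp F rF labF bF fF eF => [|[|[|[|m]]]] // _ n3 injp F rF labF bF fF eF.
  (* In the triangle [p 1] is the neighbour of both ends, so the colon ideal is generated by a
     single variable. *)
  have triv := trivial_resolves K V.
  have [//|//|//|Phi1 rG] := @cone_exists K V _ _ _ _ [set p 1%N] triv triv.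
  have [|||Phi rX] := cone_exists rF rG (E := [set p 0%N; p 2]).
  - exact: has_path_edge_mono.
  - exact/mono_or.
  - move=> U; rewrite subUset !sub1set => /andP[p0 p2].
    by rewrite /has_path_edge /= p0 p2 andbT !orbF orbb.
  exists (cone [set p 0%N; p 2] Phi); split=> //.
  - move=> a; case: (split_ordP a) => [i ->|i ->] /=; rewrite inE !sumcaseE.
      by move=> /bF.
    rewrite !inE; case: (split_ordP i) => [c ->|c ->]; rewrite !sumcaseE => _ /=.
      by apply: leq_trans (card_setU2_le _ _ (eq_leq (cards0 _))) _.
    apply: leq_trans (card_setU2_le _ _ (card_setU1_le _ (eq_leq (cards0 _)))) _.
    by [].
  - move=> a; case: (split_ordP a) => [i ->|i ->] /=; rewrite inE !sumcaseE.
      by move=> iF /(fF _ iF)[].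
    rewrite !inE; case: (split_ordP i) => [c ->|c ->]; rewrite !sumcaseE => _ //=.
    by move=> /(_ 1%N isT); rewrite !inE => /or3P[//|/eqP/injp jE|/eqP/injp jE]; have := jE; lia.
  - exists (rshift _ (rshift _ ord0)); rewrite /= ?inE ?sumcaseE ?inE ?sumcaseE ?inE //.
    by case=> [|[|[|j]]] // _; rewrite !inE eqxx ?orbT.
have [|G [rG labG bG fG eG]] := @path_resolution_exists (fun j => p j.+2) m.
  by move=> i j im jm /injp jE; have := jE; lia.
(* The neighbours [p 1] and [p m.+2] of the two ends are adjoined as variables, each by a cone of a
   complex with itself. *)
have [|||Phi1 rG1] := cone_exists rG rG (E := [set p 1%N]); try exact: has_path_edge_mono.
  by [].
have monoG1 := mono_or (E := [set p 1%N]) (@has_path_edge_mono (fun j => p j.+2) m).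
have [|||Phi2 rG2] := cone_exists rG1 rG1 (E := [set p m.+2]); try exact: monoG1.
  by [].
have [|||Phi rX] := cone_exists rF rG2 (E := [set p 0%N; p m.+3]).
- exact: has_path_edge_mono.
- exact: mono_or monoG1.
- move=> U; rewrite subUset !sub1set => /andP[p0 pm3].
  by rewrite path_cat_edges.
exists (cone [set p 0%N; p m.+3] Phi); split=> //.
- move=> a; case: (split_ordP a) => [i ->|i ->] /=; rewrite inE !sumcaseE.
    by move=> /bF h; lia.
  rewrite !inE; case: (split_ordP i) => [c ->|c ->]; rewrite !sumcaseE inE;
    case: (split_ordP c) => [d ->|d ->]; rewrite !sumcaseE => /bG h.
  + by apply: leq_trans (card_setU2_le _ _ h) _; lia.
  + by apply: leq_trans (card_setU2_le _ _ (card_setU1_le _ h)) _; lia.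
  + by apply: leq_trans (card_setU2_le _ _ (card_setU1_le _ h)) _; lia.
  + by apply: leq_trans (card_setU2_le _ _ (card_setU1_le _ (card_setU1_le _ h))) _; lia.
- move=> a; case: (split_ordP a) => [i ->|i ->] /=; rewrite inE !sumcaseE.
    by move=> iF /(fF _ iF) h; lia.
  have notlab c j : c \in act G -> p j \in lab c -> (j < m.+4)%N -> (1 < j < m.+2)%N.
    by move=> cG /(labG _ _ cG)[k km /injp kE] jm; have := kE; lia.
  rewrite !inE; case: (split_ordP i) => [c ->|c ->]; rewrite !sumcaseE inE;
    case: (split_ordP c) => [d ->|d ->]; rewrite !sumcaseE => dG full.
  + have := full 1%N isT; rewrite !inE => /or3P[/(notlab _ _ dG)|/eqP/injp jE|/eqP/injp jE].
    * by lia.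
    * by have := jE; lia.
    * by have := jE; lia.
  + have := full m.+2 (leqnSn _); rewrite !inE => /or3P[/orP[/(notlab _ _ dG)|/eqP/injp jE]|/eqP/injp jE|/eqP/injp jE].
    * by lia.
    * by have := jE; lia.
    * by have := jE; lia.
    * by have := jE; lia.
  + have := full 1%N isT; rewrite !inE => /or3P[/orP[/(notlab _ _ dG)|/eqP/injp jE]|/eqP/injp jE|/eqP/injp jE].
    * by lia.
    * by have := jE; lia.
    * by have := jE; lia.
    * by have := jE; lia.
  + have [|] := fG _ dG; last by lia.
    move=> j jm; have jm3 : (j.+2 < m.+4)%N by lia.
    have := full j.+2 jm3.
    rewrite !inE => /or3P[/orP[/orP[h|/eqP/injp jE]|/eqP/injp jE]|/eqP/injp jE|/eqP/injp jE];
      by [exact: h | have := jE; lia].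
- have [m0|m0] := eqVneq (m.+4 %% 3)%N 0%N.
    have [|a aF full] := eF; first by lia.
    exists (lshift _ a); rewrite /= ?inE !sumcaseE //.
  have [|c cG full] := eG; first by lia.
  exists (rshift _ (rshift _ (rshift _ c))); rewrite /= ?inE !sumcaseE ?inE ?sumcaseE ?inE ?sumcaseE //.
  move=> j jm; rewrite !inE.
  have [->|j0] := eqVneq j 0%N; first by rewrite eqxx !orbT.
  have [->|j1] := eqVneq j 1%N; first by rewrite eqxx !orbT.
  have [->|j2] := eqVneq j m.+2; first by rewrite eqxx !orbT.
  have [->|j3] := eqVneq j m.+3; first by rewrite eqxx !orbT.
  have -> : j = j.-2.+2 by lia.
  by rewrite full //; lia.
Qed.

End MinimalAndCycles.

(** * From labelled complexes to graded resolutions *)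

Section IdealSpan.
Variables (K : fieldType) (n : nat) (Q : {mpoly K[n]} -> Prop).

Lemma ideal_span0 : ideal_span Q 0.
Proof.
exists 0%N, (fun _ => 0), (fun _ => 0); split; first by case.
by rewrite big_ord0.
Qed.

Lemma ideal_spanMl p f : Q f -> ideal_span Q (p * f).
Proof.
move=> Qf; exists 1%N, (fun _ => p), (fun _ => f); split=> //.
by rewrite big_ord1.
Qed.

Lemma ideal_spanD f g : ideal_span Q f -> ideal_span Q g -> ideal_span Q (f + g).
Proof.
move=> [k [c [p [Qp ->]]]] [l [d [q [Qq ->]]]].
exists (k + l)%N, (sumcase c d), (sumcase p q); split.
  by move=> i; case: (split_ordP i) => j ->; rewrite sumcaseE.
rewrite big_split_ord /=; congr (_ + _);
by apply: eq_bigr => i _; rewrite !sumcaseE.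
Qed.

Lemma ideal_span_sum (J : finType) (F : J -> {mpoly K[n]}) :
  (forall j, ideal_span Q (F j)) -> ideal_span Q (\sum_j F j).
Proof.
by move=> QF; apply: big_ind => //; [apply: ideal_span0|apply: ideal_spanD].
Qed.

End IdealSpan.

Section Homogenization.
Variables (K : fieldType) (n : nat) (w : 'I_n -> nat).
Hypothesis w_gt0 : forall x, (0 < w x)%N.
Local Notation S := {mpoly K[n]}.
Implicit Types (A B U : {set 'I_n}) (u m : 'X_{1..n}).

Definition wmon A : 'X_{1..n} := [multinom (if x \in A then w x else 0%N) | x < n].

(** In multidegree [u] the substituted complex is the strand of the labelled one at this set. *)
Definition wlevel u : {set 'I_n} := [set x | w x <= u x]%N.

Lemma wmon_le A u : (wmon A <= u)%MM = (A \subset wlevel u).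
Proof.
apply/mnm_lepP/subsetP => [h x xA|h x]; first by have := h x; rewrite mnmE xA inE.
by rewrite mnmE; case: ifP => // /h; rewrite inE.
Qed.

Lemma wmonS A B : A \subset B -> (wmon A <= wmon B)%MM.
Proof.
move=> AB; rewrite wmon_le; apply: subset_trans AB _; apply/subsetP => x xB.
by rewrite inE mnmE xB.
Qed.

Lemma wmon0 : wmon set0 = 0%MM.
Proof. by apply/mnmP => x; rewrite !mnmE inE. Qed.

Lemma mdeg_wmon A : mdeg (wmon A) = (\sum_(x in A) w x)%N.
Proof. by rewrite mdegE [RHS]big_mkcond; apply: eq_bigr => x _; rewrite mnmE. Qed.

Lemma mcoeffMX_le (p : S) k m :
  (p * 'X_[k])@_m = if (k <= m)%MM then p@_(m - k) else 0.
Proof.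
case: ifP => [km|km]; first by have := mcoeffMX p k (m - k)%MM; rewrite addmC submK.
apply/eqP; rewrite mcoeff_eq0 (perm_mem (msuppMX p k)).
by apply/negP => /mapP[l _ ml]; rewrite ml lem_addr in km.
Qed.

Variables (X : lcomplex K 'I_n) (P : {set 'I_n} -> bool).
Hypothesis rX : resolves X P.
Local Notation N := (lsize X).
Local Notation mon a := (wmon (lab a)).

(** Each scalar entry is multiplied by the quotient of the substituted label monomials; the
    truncated subtraction of exponents is a true quotient where the entry is nonzero, by
    [mon_dif]. *)
Definition hdif : 'M[S]_N := \matrix_(a, b) (dif X a b *: 'X_[mon a - mon b]).

(** The component of [v] in multidegree [u], read as a row of coefficients; [embed] is the way
    back. *)
Definition slice u (v : 'rV[S]_N) : 'rV[K]_N :=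
  \row_a (if (mon a <= u)%MM then (v 0 a)@_(u - mon a) else 0).

Definition embed u (z : 'rV[K]_N) : 'rV[S]_N := \row_a (z 0 a *: 'X_[u - mon a]).

Lemma mon_dif a b : dif X a b != 0 -> (mon b <= mon a)%MM.
Proof. by move=> /(dif_neq0 rX)[_ _ ? _]; apply: wmonS. Qed.

Lemma submD m1 m2 m3 : (m1 <= m2)%MM -> (m2 <= m3)%MM ->
  ((m3 - m2) + (m2 - m1) = m3 - m1)%MM.
Proof.
move=> /mnm_lepP h1 /mnm_lepP h2; apply/mnmP => x; rewrite !mnmE.
by have := h1 x; have := h2 x; lia.
Qed.

Lemma slice_mul u v : slice u (v *m hdif) = slice u v *m dif X.
Proof.
apply/rowP => b; rewrite !mxE; case: ifP => bu.
  rewrite raddf_sum /=; apply: eq_bigr => a _; rewrite !mxE.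
  have [->|ab] := eqVneq (dif X a b) 0; first by rewrite scale0r !mulr0 mcoeff0.
  have ba := mon_dif ab.
  rewrite -scalerAr mcoeffZ mcoeffMX_le mulrC.
  have -> : (mon a - mon b <= u - mon b)%MM = (mon a <= u)%MM.
    apply/mnm_lepP/mnm_lepP => h x; have := h x; rewrite ?mnmBE;
    by move/mnm_lepP: ba => /(_ x); move/mnm_lepP: bu => /(_ x); lia.
  case: ifP => // au; congr (_@_ _ * _); apply/mnmP => x; rewrite !mnmBE.
  by move/mnm_lepP: ba => /(_ x); move/mnm_lepP: au => /(_ x); lia.
rewrite big1 // => a _; rewrite mxE.
have [->|ab] := eqVneq (dif X a b) 0; first by rewrite mulr0.
case: ifP => [au|]; last by rewrite mul0r.
by rewrite (lepm_trans (mon_dif ab) au) in bu.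
Qed.

Lemma embed_mul u z : @supported _ _ X (wlevel u) z ->
  embed u z *m hdif = embed u (z *m dif X).
Proof.
move=> sz; apply/rowP => b; rewrite !mxE scaler_suml; apply: eq_bigr => a _.
rewrite !mxE; have [->|za] := eqVneq (z 0 a) 0; first by rewrite mul0r !scale0r mul0r.
have [->|ab] := eqVneq (dif X a b) 0; first by rewrite mulr0 !scale0r mulr0.
rewrite -scalerAl -scalerAr scalerA -mpolyXD submD //; first exact: mon_dif.
by rewrite wmon_le; have /andP[] := sz _ za.
Qed.

Lemma embed_slice (v : 'rV[S]_N) :
  exists us : seq 'X_{1..n}, v = \sum_(u <- us) embed u (slice u v).
Proof.
exists (undup [seq (m + mon a)%MM | a <- enum 'I_N, m <- msupp (v 0 a)]).
apply/rowP => a; rewrite summxE; apply/mpolyP => m; rewrite raddf_sum /=.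
under eq_bigr do rewrite !mxE mcoeffZ mcoeffX.
set us := undup _; pose u0 := (m + mon a)%MM.
have other u : u != u0 ->
    (if (mon a <= u)%MM then (v 0 a)@_(u - mon a) else 0) *
      ((u - mon a)%MM == m)%:R = 0.
  move=> uu0; case: ifP => [au|]; last by rewrite mul0r.
  case: eqP => [um|]; last by rewrite mulr0.
  by rewrite /u0 -um (submK au) eqxx in uu0.
have [u0s|u0s] := boolP (u0 \in us).
  rewrite (bigD1_seq u0) ?undup_uniq //= big1 => [|u /other//].
  by rewrite addr0 lem_addl addmK eqxx mulr1.
rewrite big_seq big1 => [|u us_u]; last by apply: other; apply: contraNneq u0s => <-.
apply/eqP; rewrite mcoeff_eq0; apply: contra u0s => mv.
by rewrite mem_undup; apply/allpairsPdep; exists a, m; rewrite mem_enum.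
Qed.

(** A cycle is the sum of its multigraded components, and each of these is a boundary by exactness
    of the strand at [wlevel u]. *)
Lemma hdif_exact (v : 'rV[S]_N) : (forall a, v 0 a != 0 -> a \in act X) ->
  v 0 (base X) = 0 -> v *m hdif = 0 -> exists z, v = z *m hdif.
Proof.
move=> av vb vD; have [us ->] := embed_slice v.
elim: us => [|u us [z IH]]; first by exists 0; rewrite big_nil mul0mx.
rewrite big_cons IH.
have [|||y [sy vy]] := dif_exact rX (U := wlevel u) (v := slice u v).
- move=> a; rewrite mxE; case: ifP => [au va|]; last by rewrite eqxx.
  rewrite -wmon_le au andbT; apply: av; apply: contraNneq va => ->.
  by rewrite mcoeff0.
- by rewrite -slice_mul vD; apply/rowP => a; rewrite !mxE mcoeff0 if_same.
- by left; rewrite mxE vb mcoeff0 if_same.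
by exists (embed u y + z); rewrite mulmxDl embed_mul // -vy.
Qed.

Lemma hdif_hdif : hdif *m hdif = 0.
Proof.
apply/matrixP => a c; rewrite !mxE.
transitivity ((dif X *m dif X) a c *: 'X_[K, (mon a - mon c)%MM]); last first.
  by rewrite (dif_dif rX) mxE scale0r.
rewrite mxE scaler_suml; apply: eq_bigr => b _; rewrite !mxE.
have [->|ab] := eqVneq (dif X a b) 0; first by rewrite mul0r !scale0r mul0r.
have [->|bc] := eqVneq (dif X b c) 0; first by rewrite mulr0 !scale0r mulr0.
by rewrite -scalerAl -scalerAr scalerA -mpolyXD submD // mon_dif.
Qed.

Lemma hdif_base U : P U ->
  exists z : 'rV[S]_N, 'X_[wmon U] *: delta_mx 0 (base X) = z *m hdif.
Proof.
move=> PU.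
have [|||y [sy vy]] := dif_exact rX (U := U) (v := delta_mx 0 (base X)).
- by apply: supported_delta; rewrite ?(base_act rX) // (base_lab rX) sub0set.
- by rewrite -rowE (row_dif_hdeg0 rX (base_hdeg rX)).
- by right.
exists (embed (wmon U) y); rewrite embed_mul -?vy.
  apply/rowP => a; rewrite !mxE eqxx /=; case: eqP => [->|_].
    by rewrite mulr1 scale1r (base_lab rX) wmon0 subm0.
  by rewrite mulr0 scale0r.
move=> a /sy/andP[-> aU]; rewrite (subset_trans aU) //.
by rewrite -wmon_le wmonS.
Qed.

Lemma hdif_neq0 a b : hdif a b != 0 -> dif X a b != 0.
Proof. by rewrite mxE; apply: contraNneq => ->; rewrite scale0r. Qed.

Definition gens k : {set 'I_N} := [set a in act X | hdeg a == k].

Definition gen k (i : 'I_#|gens k|) : 'I_N := enum_val i.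

Lemma mem_gens k (i : 'I_#|gens k|) : gen i \in gens k.
Proof. exact: enum_valP. Qed.

Lemma gen_eq k (i j : 'I_#|gens k|) : (gen i == gen j) = (i == j).
Proof. exact: (inj_eq enum_val_inj). Qed.

(** Term [i] is spanned by the generators of degree [i.+1]: the base belongs to a resolution of the
    quotient and is absent from one of the ideal. The entries into the base form [aug]. *)
Definition homogenization : free_complex K n :=
  @FreeComplex K n (fun i => #|gens i.+1|)
    (fun i a => \sum_(x in lab (gen a)) w x)%N
    (fun i => mxsub (@gen i.+2) (@gen i.+1) hdif)
    (\col_a hdif (gen a) (base X)).

Lemma hdif_graded a b : degree_preserving (hdif a b)
  (\sum_(x in lab a) w x)%N (\sum_(x in lab b) w x)%N.
Proof.
move=> m; have [h|/hdif_neq0 ab] := eqVneq (hdif a b) 0.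
  by rewrite h mcoeff_msupp mcoeff0 eqxx.
rewrite mxE msuppMCX // inE => /eqP->.
by rewrite -!mdeg_wmon -mdegD submK // mon_dif.
Qed.

Lemma homogenization_graded : is_graded homogenization.
Proof.
split=> [a|i b a] /=; last by rewrite mxE; apply: hdif_graded.
by have := @hdif_graded (gen a) (base X); rewrite (base_lab rX) big_set0 mxE.
Qed.

(** A nonzero entry strictly shrinks the label, and positive weights then make the quotient monomial
    nonconstant. *)
Lemma homogenization_minimal :
  (forall a b, dif X a b != 0 -> lab a != lab b) -> is_minimal homogenization.
Proof.
move=> minX i b a; rewrite /= !mxE mcoeffZ mcoeffX.
have [->|ba] := eqVneq (dif X (gen b) (gen a)) 0; first by rewrite mul0r.
have [_ _ sub _] := dif_neq0 rX ba.
have [x xb xa] : exists2 x, x \in lab (gen b) & x \notin lab (gen a).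
  by apply/subsetPn; apply: contra (minX _ _ ba) => ?; rewrite eqEsubset sub andbT.
case: eqP => [/mnmP/(_ x)|]; last by rewrite mulr0.
by rewrite !mnmE xb (negPf xa) subn0; have := w_gt0 x; lia.
Qed.

Lemma restrict_mul k p (z : 'rV[S]_N) (f : 'I_p -> 'I_N) :
  (forall a c, hdif a (f c) != 0 -> a \in gens k) ->
  colsub f (z *m hdif) =
  colsub (@gen k) z *m mxsub (@gen k) f hdif.
Proof.
move=> hk; apply/rowP => c; rewrite !mxE.
rewrite (bigID (mem (gens k))) /= [X in _ + X]big1 => [|a ak]; last first.
  by have [->|/hk] := eqVneq (hdif a (f c)) 0; rewrite ?mulr0 // (negPf ak).
rewrite addr0 big_enum_val; apply: eq_bigr => a _; by rewrite !mxE.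
Qed.

(* The map f enumerates the generators of degree k. It is kept abstract to cover
   the augmentation, where it is constant with value the base. *)
Lemma hdif_exact_at k p (f : 'I_p -> 'I_N) :
  (forall a c, hdif a (f c) != 0 -> a \in gens k.+1) ->
  (forall b, b \in gens k -> exists c, b = f c) ->
  forall v : 'rV[S]_#|gens k.+1|,
    v *m mxsub (@gen k.+1) f hdif = 0 <->
    exists y, v = y *m mxsub (@gen k.+2)
                             (@gen k.+1) hdif.
Proof.
move=> fk fonto v.
have toS j a (c : 'I_#|gens j|) : hdif a (gen c) != 0 -> a \in gens j.+1.
  move=> /hdif_neq0/(dif_neq0 rX)[aX _ _ ha].
  by have := mem_gens c; rewrite !inE aX ha => /andP[_ /eqP->] /=.
split=> [vD|[y ->]]; last first.
  have -> : y = colsub (@gen k.+2)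
      (y *m rowsub (@gen k.+2) 1%:M).
    rewrite -mulmx_colsub.
    suff -> : colsub (@gen k.+2)
      (rowsub (@gen k.+2) 1%:M) = 1%:M :> 'M[S]_ _.
      by rewrite mulmx1.
    by apply/matrixP => a b; rewrite !mxE gen_eq.
  rewrite -restrict_mul; last by move=> a c; apply: toS.
  rewrite -restrict_mul; last by move=> a c; apply: fk.
  by rewrite -mulmxA hdif_hdif mulmx0; apply/rowP => a; rewrite !mxE.
pose e : 'rV[S]_N := v *m rowsub (@gen k.+1) 1%:M.
have eE a : e 0 a = \sum_i v 0 i * (gen i == a)%:R.
  by rewrite mxE; apply: eq_bigr => i _; rewrite !mxE.
have eN a : e 0 a != 0 -> a \in gens k.+1.
  rewrite eE => /sum_neq0[i]; case: (gen i =P a) => [<- _|]; first exact: mem_gens.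
  by rewrite mulr0 eqxx.
have [|||z ez] := hdif_exact (v := e).
- by move=> a /eN; rewrite inE => /andP[].
- by apply/eqP; apply: contraT => /eN; rewrite inE (base_hdeg rX) andbF.
- apply/rowP => b; rewrite [RHS]mxE.
  have [bk|bk] := boolP (b \in gens k).
    have [c ->] := fonto b bk.
    transitivity ((v *m mxsub (@gen k.+1) f hdif) 0 c); last by rewrite vD mxE.
    rewrite /e -mulmxA -rowsubE !mxE; apply: eq_bigr => i _; by rewrite !mxE.
  rewrite mxE big1 // => a _; have [->|/eN] := eqVneq (e 0 a) 0; first by rewrite mul0r.
  have [->|/hdif_neq0/(dif_neq0 rX)[_ bX _ hab]] := eqVneq (hdif a b) 0.
    by rewrite mulr0.
  by rewrite inE hab eqSS => /andP[_ hb]; rewrite inE bX hb in bk.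
exists (colsub (@gen k.+2) z).
rewrite -restrict_mul; last by move=> a c; apply: toS.
rewrite -ez; apply/rowP => c; rewrite mxE eE (bigD1 c) //= eqxx mulr1 big1 ?addr0 //.
by move=> i ic; rewrite gen_eq (negPf ic) mulr0.
Qed.

Variable Q : S -> Prop.
(** Together with [mon_Q], this says that [Q] generates the same ideal as the substituted monomials
    of the sets in [P]. *)
Hypothesis Q_mon : forall f, Q f -> exists2 U, P U & f = 'X_[wmon U].
Hypothesis mon_Q : forall U, P U -> exists p f, Q f /\ 'X_[wmon U] = p * f.

Lemma base_unique b : b \in gens 0 -> b = base X.
Proof. by rewrite inE => /andP[bX /eqP]; apply: (hdeg_base rX). Qed.

Lemma base_gens a : hdif a (base X) != 0 -> a \in gens 1.
Proof.
by move=> /hdif_neq0/(dif_neq0 rX)[aX _ _ ha]; rewrite inE aX ha (base_hdeg rX).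
Qed.

Lemma homogenization_resolution : is_resolution homogenization (ideal_span Q).
Proof.
have augE : aug homogenization =
    mxsub (@gen 1) (fun _ : 'I_1 => base X) hdif.
  by apply/matrixP => a b; rewrite !mxE.
split.
- move=> f0; split=> [[m [c [g [Qg ->]]]]|[v <-]].
    have /fin_all_exists[v hv] i : exists v : 'rV_#|gens 1|,
        (v *m aug homogenization) 0 0 = g i.
      have [U PU ->] := Q_mon (Qg i); have [z hz] := hdif_base PU.
      exists (colsub (@gen 1) z); rewrite augE -restrict_mul.
        by rewrite -hz !mxE !eqxx mulr1.
      by move=> a _; apply: base_gens.
    exists (\sum_i c i *: v i); rewrite mulmx_suml summxE; apply: eq_bigr => i _.
    by rewrite -scalemxAl mxE hv.
  rewrite mxE; apply: ideal_span_sum => a; rewrite !mxE.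
  have [->|ab] := eqVneq (dif X (gen a) (base X)) 0.
    by rewrite scale0r mulr0; apply: ideal_span0.
  have [p [f [Qf fE]]] := mon_Q (dif_base rX ab).
  rewrite (base_lab rX) wmon0 subm0 fE -scalerAr mulrA scalerAl.
  exact: ideal_spanMl.
- rewrite augE; apply: hdif_exact_at => [a _|b /base_unique]; first exact: base_gens.
  by exists ord0.
- move=> i; apply: hdif_exact_at => [a c|b bk].
    move=> /hdif_neq0/(dif_neq0 rX)[aX _ _ ha].
    by have := mem_gens c; rewrite !inE aX ha => /andP[_ /eqP->] /=.
  by exists (enum_rank_in bk b); rewrite /gen enum_rankK_in.
Qed.

(** The full label contributes [\sum_x w x - h], where the index shift turns [h.+1] into [h], and
    [bound] says that no generator contributes more. *)
Lemma homogenization_has_reg h :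
  (forall a b, dif X a b != 0 -> lab a != lab b) ->
  (exists2 a, a \in act X & lab a = setT /\ hdeg a = h.+1) ->
  (forall a, a \in act X -> (\sum_(x in lab a) w x + h.+1 <= \sum_x w x + hdeg a)%N) ->
  has_reg (ideal_span Q) ((\sum_x w x)%N%:Z - h%:Z).
Proof.
move=> minX [a aX [aT ah]] bound; exists homogenization; split.
- exact: homogenization_graded.
- exact: homogenization_resolution.
- exact: homogenization_minimal.
- exists h, (\sum_x w x)%N; split=> //; apply/eqP; rewrite -lt0n.
  have ag : a \in gens h.+1 by rewrite inE aX ah eqxx.
  apply/card_gt0P; exists (enum_rank_in ag a); rewrite inE /= /gen enum_rankK_in // aT.
  by apply/eqP; apply: eq_bigl => x; rewrite inE.
- move=> i j /eqP; rewrite -lt0n => /card_gt0P[b]; rewrite inE /= => /eqP<-.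
  have := mem_gens b; rewrite inE => /andP[/bound + /eqP hb]; rewrite hb.
  by move: (\sum_(x in _) w x)%N (\sum_(x < n) w x)%N => s t; lia.
Qed.

End Homogenization.

(** * Regularity of edge ideals of cycles *)

Lemma has_cycle_edgeP n (U : {set 'I_n.+1}) :
  reflect (exists x y, [/\ cycle_adj x y, x \in U & y \in U])
    (has_path_edge (@inord n) n.+1 U || ([set inord 0; inord n] \subset U)).
Proof.
have ordS_inord j : (j < n)%N -> inord j.+1 = ordS (inord j : 'I_n.+1).
  by move=> jn; apply: val_inj; rewrite /= !inordK ?modn_small //; lia.
have ordS_max : ordS (inord n) = inord 0 :> 'I_n.+1.
  by apply: val_inj; rewrite /= !inordK // modnn.
apply: (iffP orP) => [[/has_path_edgeP[j [jn pj pj1]]|]|].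
- exists (inord j), (inord j.+1); split=> //.
  by rewrite /cycle_adj ordS_inord ?eqxx.
- rewrite subUset !sub1set => /andP[p0 pn]; exists (inord n), (inord 0); split=> //.
  by rewrite /cycle_adj ordS_max eqxx.
have next x : x \in U -> ordS x \in U ->
    has_path_edge (@inord n) n.+1 U \/ [set inord 0; inord n] \subset U.
  move=> xU; have [xn|nx] := ltnP x n.
    rewrite -[x in ordS x]inord_val -ordS_inord // => yU; left; apply/has_path_edgeP.
    by exists x; rewrite inord_val.
  have -> : x = inord n by apply: val_inj; rewrite /= inordK //; have := ltn_ord x; lia.
  have xE : inord n = x by apply: val_inj; rewrite /= inordK //; have := ltn_ord x; lia.
  by rewrite ordS_max => U0; right; rewrite subUset !sub1set U0 xE.
by case=> x [y [/orP[/eqP yx|/eqP xy] xU yU]]; [apply: (next x)|apply: (next y)];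
  rewrite -?yx -?xy.
Qed.

(** The integer [h] is chosen before the weights, so the same [h] serves for a weighted cycle and
    for its underlying graph and cancels in the difference. *)
Lemma cycle_has_reg (K : fieldType) n : (2 < n)%N -> (n %% 3 <> 2)%N ->
  exists h : nat, forall (w : 'I_n -> nat) (Q : {mpoly K[n]} -> Prop),
    (forall x, (0 < w x)%N) ->
    (forall f, Q f <-> exists x y, cycle_adj x y /\ f = 'X_[wmon w [set x; y]]) ->
    has_reg (ideal_span Q) ((\sum_x w x)%N%:Z - h%:Z).
Proof.
case: n => // n n2 n3.
have [|X [rX bX fX [a aX full]]] := @cycle_resolution_exists K 'I_n.+1 (@inord n) n.+1 n2 n3.
  by move=> i j im jm /(congr1 val); rewrite /= !inordK.
pose P (U : {set 'I_n.+1}) :=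
  has_path_edge (@inord n) n.+1 U || ([set inord 0; inord n] \subset U).
have labT (A : {set 'I_n.+1}) : (forall j, (j < n.+1)%N -> inord j \in A) -> A = setT.
  move=> fA; apply/setP => x; rewrite inE.
  by have := fA x (ltn_ord x); rewrite inord_val.
have [||||Y [rY minY subY [b bY bT]]] := minimal_lcomplex (A := setT) rX.
- by apply/has_cycle_edgeP => -[x [y [_]]]; rewrite inE.
- exact/mono_or/has_path_edge_mono.
- move=> c d cX dX cT dT.
  have fc := fX _ cX; have fd := fX _ dX.
  have {}fc : (hdeg c + n.+1 %/ 3 = n.+1)%N by apply: fc => j _; rewrite cT inE.
  have {}fd : (hdeg d + n.+1 %/ 3 = n.+1)%N by apply: fd => j _; rewrite dT inE.
  by lia.
- by exists a => //; apply: labT.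
(* The full label has degree [n.+1 - n.+1 %/ 3] in the resolution of the quotient, hence one less in
   that of the ideal. *)
exists (n.+1 - n.+1 %/ 3).-1 => w Q w0 hQ.
apply: (homogenization_has_reg w0 rY) => //.
- move=> f /hQ[x [y [xy ->]]]; exists [set x; y] => //.
  by apply/has_cycle_edgeP; exists x, y; rewrite !inE !eqxx orbT.
- move=> U /has_cycle_edgeP[x [y [xy xU yU]]].
  exists 'X_[wmon w U - wmon w [set x; y]], 'X_[wmon w [set x; y]].
  split; first by apply/hQ; exists x, y.
  rewrite -mpolyXD submK // wmonS //.
  by apply/subsetP => z; rewrite !inE => /orP[]/eqP->.
- exists b => //; split=> //.
  have [c cX [clab chdeg]] := subY _ bY.
  have : (hdeg c + n.+1 %/ 3 = n.+1)%N.
    by apply: (fX _ cX) => j _; rewrite clab bT inE.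
  by rewrite chdeg; lia.
move=> d /subY[c /bX + [<- <-]].
(* Each vertex outside the label has weight at least one, so the bound on the number of vertices
   yields the weighted bound. *)
have : (\sum_x w x >= \sum_(x in lab c) w x + (n.+1 - #|lab c|))%N.
  rewrite [X in (_ <= X)%N](bigID (mem (lab c))) /= leq_add2l.
  have -> : (n.+1 - #|lab c| = \sum_(x | x \notin lab c) 1)%N.
    have -> : (\sum_(x | x \notin lab c) 1 = #|~: lab c|)%N.
      by rewrite -sum1_card; apply: eq_bigl => x; rewrite inE.
    by have := cardsC (lab c); rewrite card_ord; lia.
  by apply: leq_sum.
move: (\sum_(x in _) w x)%N (\sum_(x < _) w x)%N (#|lab c|) => s t k.
by lia.
Qed.

Theorem theorem4p4 (K : fieldType) (n : nat) (D : wograph n)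
    (cycD : is_wocycle D)
    (n_mod3 : n = 0 %[mod 3] \/ n = 1 %[mod 3])
    (sinkD : forall x, x \in Vplus D -> is_sink (arcs D) x) :
  reg (wo_edge_ideal K D) =
    reg (edge_ideal K (underlying (arcs D)))
      + \sum_(x in Vplus D) ((weight D x)%:Z - 1).
Proof.
have [n2 adjD] := cycD.
have n3 : (n %% 3 <> 2)%N by lia.
have [h regE] := @cycle_has_reg K n n2 n3.
have neq x y : underlying (arcs D) x y -> x != y.
  apply: contraTneq => ->; rewrite /underlying orbb.
  by apply/negP => yy; have := arcs_asym yy; rewrite yy.
rewrite (regP (r := (\sum_x weight D x)%N%:Z - h%:Z)); last first.
  apply: regE => [x|f]; first exact: weight_gt0.
  have arcE x y : arcs D x y ->
      'X_x * 'X_y ^+ weight D y = 'X_[wmon (weight D) [set x; y]] :> {mpoly K[n]}.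
    move=> xy; have xy' : x != y by apply: neq; rewrite /underlying xy.
    (* The tail of an arc is no sink, so it lies outside [Vplus D] and has weight one; the generator
       is thus a substituted edge monomial. *)
    have wx : weight D x = 1%N.
      have := weight_gt0 D x; case: (ltngtP (weight D x) 1%N) => // w1 _.
      have := sinkD x; rewrite inE => /(_ w1 y); rewrite /underlying xy => /(_ isT) yx.
      by have := arcs_asym xy; rewrite yx.
    rewrite mpolyXn -mpolyXD; congr 'X_[_]; apply/mnmP => z.
    rewrite mnmDE mulmnE !mnm1E mnmE !inE (eq_sym z x) (eq_sym z y).
    case: (x =P z) => [<-|_]; first by rewrite wx (eq_sym y) (negPf xy') addn0.
    by case: (y =P z) => [<-|_]; rewrite ?add0n ?mul1n.
  split=> [[x [y [xy ->]]]|[x [y [xy ->]]]].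
    by exists x, y; rewrite -adjD /underlying xy arcE.
  move: xy; rewrite -adjD => /orP[xy|yx]; first by exists x, y; rewrite arcE.
  by exists y, x; rewrite arcE // setUC.
rewrite (regP (r := (\sum_(x < n) 1)%N%:Z - h%:Z)); last first.
  apply: (regE (fun _ => 1%N)) => // f.
  have adjE x y : cycle_adj x y ->
      'X_x * 'X_y = 'X_[wmon (fun _ => 1%N) [set x; y]] :> {mpoly K[n]}.
    move=> xy; have xy' : x != y by apply: neq; rewrite adjD.
    rewrite -mpolyXD; congr 'X_[_]; apply/mnmP => z.
    rewrite mnmDE !mnm1E mnmE !inE (eq_sym z x) (eq_sym z y).
    by case: (x =P z) => [<-|//]; rewrite (eq_sym y) (negPf xy').
  by split=> -[x [y [xy ->]]]; exists x, y; rewrite ?adjD adjE // -?adjD.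
rewrite addrAC; congr (_ - _).
(* Outside [Vplus D] the weight is one, so extending the sum of [weight D x - 1] to all vertices
   adds only zeros. *)
rewrite !(big_morph Posz PoszD (erefl _)) [X in _ + X]big_mkcond -big_split.
apply: eq_bigr => x _; rewrite inE; have := weight_gt0 D x.
by case: ifP => /=; lia.
Qed.
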